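(* Let $m,r$ be positive integers and $\varepsilon>0$ a real number with $r\ge (2m-1)(2m/\varepsilon+1)$. Let $G$ be a graph with $iso(G\setminus S)\le \frac{|S|}{r+1}$ for all $S\subseteq V(G)$. If for all $S\subseteq V(G)$ $$\omega(G\setminus S)\le \frac{1}{2m+\varepsilon}|S|+1,$$ then $G$ has an $m$-tree-connected $\{r,r+1\}$-factor.
   Context: Graphs are finite, have no loops, but may have multiple edges; degrees count multiplicities. For $S\subseteq V(G)$, $G\setminus S$ is the graph obtained by deleting $S$; $\omega(\cdot)$ is the number of connected components and $iso(\cdot)$ the number of isolated vertices. A graph is $m$-tree-connected if it contains $m$ edge-disjoint spanning trees. For a set $A$ of integers, an $A$-factor is a spanning subgraph all of whose vertex degrees lie in $A$. *)

(* Defs.v *)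
From mathcomp Require Import all_boot.
Set Implicit Arguments. Unset Strict Implicit. Unset Printing Implicit Defensive.

(* A finite multigraph on vertex type V: a finite type E of edges with an
   endpoint map ends : E -> V * V.  Multiple edges = distinct edges with the
   same endpoints.  Spanning subgraphs are given by edge sets F : {set E}. *)

Section Multigraph.
Variables (V E : finType) (ends : E -> V * V).

Definition loopless : Prop := forall e : E, (ends e).1 != (ends e).2.

Definition joins (e : E) (x y : V) : bool :=
  (ends e == (x, y)) || (ends e == (y, x)).

Definition adjD (F : {set E}) (S : {set V}) : rel V :=
  fun x y => [&& x \notin S, y \notin S & [exists e in F, joins e x y]].

(* degree of v in the spanning subgraph F (no loops, so each incident edge
   counts once; multiplicities are counted) *)
Definition deg (F : {set E}) (v : V) : nat :=
  #|[set e in F | ((ends e).1 == v) || ((ends e).2 == v)]|.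

Definition omega (S : {set V}) : nat :=
  #|[set [set y | connect (adjD setT S) x y] | x in ~: S]|.

Definition iso (S : {set V}) : nat :=
  #|[set v in ~: S | [forall y, ~~ adjD setT S v y]]|.

(* T is (the edge set of) a spanning tree of G: connected on all of V and
   acyclic (every edge of T is a bridge of T) *)
Definition spanning_tree (T : {set E}) : Prop :=
  (forall x y : V, connect (adjD T set0) x y) /\
  (forall e, e \in T -> ~~ connect (adjD (T :\ e) set0) (ends e).1 (ends e).2).

Definition tree_connected (m : nat) (F : {set E}) : Prop :=
  exists T : 'I_m -> {set E},
    (forall i, T i \subset F) /\ (forall i, spanning_tree (T i)) /\
    (forall i j, i != j -> [disjoint T i & T j]).

Definition is_factor (A : pred nat) (F : {set E}) : Prop :=
  forall v : V, A (deg F v).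

End Multigraph.

(* Main.v *)
Require Import Defs.
From mathcomp Require Import all_boot zify.
From Stdlib Require Import Classical Reals Lra.
Set Implicit Arguments. Unset Strict Implicit. Unset Printing Implicit Defensive.

(* The factor is F + M, where F has all degrees r, except possibly one degree r+1,
   and M is a matching of G - F avoiding the exceptional vertex.  One may assume
   that G is simple.

   F exists: otherwise a Berge-type barrier (S,T), obtained from the jump-system
   property of degree sequences by Gallai's argument in the graph whose edges are
   subdivided twice, satisfies r|S| + sum_T (d_{G\S} - r) < omega(G\(S+T)), up to
   parity.  A greedy independent subset of T and the two toughness conditions
   contradict this.

   M exists: call an edge set sparse if every nonempty vertex set X contains at
   most m(|X|-1) of its edges; by Nash-Williams a sparse set of m(n-1) edges is a
   union of m disjoint spanning trees.  Take B0 maximal sparse in F and M largest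
   with B0 + M sparse, and suppose that B0 + M is too small.  Exchanging edges of M
   yields a set S of vertices, matched among themselves by M, such that all edges
   of G\S between the maximal tight sets of B1 := B0 + M\S are in B1.  Counting
   edges, more than 1 + (|S| + sum of their cuts)/2m of these tight sets have fewer
   than 2m edges of B1 leaving them; each has more than r vertices because F is
   simple and almost r-regular.  Deleting S and one end of each of these leaving
   edges leaves most of these sets in different components, against toughness. *)

(** * Connected components and forests *)

(** The lower bound on $r$ says exactly that $1/(2m+\varepsilon)\le (r+1-2m)/(2mr)$. Toughness thus
    becomes an inequality between natural numbers with slope $(r+1-2m)/(2mr)$, and $\varepsilon$
    disappears from the combinatorics. The exceptional degree [r+1] of $F$ is forced by parity when
    $r|V|$ is odd; [U] holds this vertex, and $M$ avoids it because degree [r+2] is not allowed. The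
    obstacle in the choice of $M$ is that it has to be a matching and independent in a matroid at
    once, so maximality says nothing about an edge that meets $M$. The exchanges are therefore
    confined to vertex sets that are tight before and after: they do not change which pairs of
    vertices are spanned, and exchanges in different tight classes can be combined. An edge of $M$
    at a vertex that no such exchange uncovers is set aside together with its ends; $S$ consists of
    these ends. On the factor side, Gallai's argument needs adjacent vertices never to be deficient
    together, which is clear only if one of the two has capacity at most one; the subdivision
    provides this. *)

Section Classes.
Variable T : finType.

Definition class (R : rel T) (x : T) : {set T} := [set y | R x y].

Definition classes (R : rel T) (D : {set T}) : {set {set T}} :=
  [set class R x | x in D].

Lemma eq_classes (R R' : rel T) D : R =2 R' -> classes R D = classes R' D.
Proof. by move=> eqR; apply: eq_imset => x; apply/setP=> y; rewrite !inE eqR. Qed.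

Lemma class_eqP (R : rel T) : equivalence_rel R ->
  forall x y, reflect (class R x = class R y) (R x y).
Proof.
move=> eqR x y; have [Rxx RR] := eqR x x x; apply: (iffP idP) => [Rxy|cxy].
  by apply/setP=> z; rewrite !inE; have [_ ->] := eqR x y z.
have : y \in class R y by rewrite inE; have [-> _] := eqR y y y.
by rewrite -cxy inE.
Qed.

Variables (R R' : rel T) (a b : T).
Hypotheses (eqR : equivalence_rel R) (eqR' : equivalence_rel R').
Hypothesis R'E : forall x y,
  R' x y = [|| R x y, R x a && R b y | R x b && R a y].

Let merge (X : {set T}) : {set T} := [set y | [exists x in X, R' x y]].

Let mergeE x : merge (class R x) = class R' x.
Proof.
apply/setP=> y; rewrite !inE; apply/exists_inP/idP => [[z]|R'xy].
  rewrite inE => Rxz R'zy; have [_ RR] := eqR' x z y; rewrite RR // R'E Rxz //.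
by exists x => //; rewrite inE; have [-> _] := eqR x x x.
Qed.

(** [merge] sends the [R]-class of [x] to its [R']-class, and two distinct classes collide only if
    one of them is that of [b]. Hence at most one class is lost, and exactly one if [a] and [b] are
    inequivalent elements of [D]. *)
Let merge_inj D : {in classes R D :\ class R b &, injective merge}.
Proof.
move=> X Y /setD1P[nb1 /imsetP[x _ eX]] /setD1P[nb2 /imsetP[y _ eY]].
rewrite eX eY in nb1 nb2 *; rewrite !mergeE => /(class_eqP eqR'); rewrite R'E => /or3P[/(class_eqP eqR)//||].
  by case/andP=> _ /(class_eqP eqR) e; rewrite e eqxx in nb2.
by case/andP=> /(class_eqP eqR) e; rewrite e eqxx in nb1.
Qed.

Lemma classes_merge_le D : #|classes R D| <= #|classes R' D|.+1.
Proof.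
rewrite (cardsD1 (class R b)) -[_.+1]add1n leq_add ?leq_b1 //.
rewrite -(card_in_imset (@merge_inj D)); apply: subset_leq_card.
apply/subsetP=> _ /imsetP[_ /setD1P[_ /imsetP[x xD ->]] ->].
by rewrite mergeE imset_f.
Qed.

Lemma classes_merge (D : {set T}) : a \in D -> b \in D -> ~~ R a b ->
  #|classes R D| = #|classes R' D|.+1.
Proof.
move=> aD bD nab; rewrite (cardsD1 (class R b)) imset_f //= add1n; congr _.+1.
rewrite -(card_in_imset (@merge_inj D)); apply: eq_card => X.
apply/imsetP/imsetP=> [[_ /setD1P[_ /imsetP[x xD ->]] ->]|[x xD ->]].
  by exists x; rewrite ?mergeE.
have Rsym u v : R u v = R v u.
  by have [Ruu RR] := eqR u v u; apply/idP/idP=> h;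
     [rewrite -RR | have [Rvv RR'] := eqR v u v; rewrite -RR'].
have Raa u : R u u by have [-> _] := eqR u u u.
have [Rbx|nbx] := boolP (R b x).
  exists (class R a); last first.
    rewrite mergeE; apply/(class_eqP eqR').
    by rewrite R'E Raa (Rsym x b) Rbx !orbT.
  rewrite !inE imset_f // andbT; apply/negP=> /eqP/(class_eqP eqR).
  exact/negP.
exists (class R x); rewrite ?mergeE // !inE imset_f // andbT.
by apply/negP=> /eqP/(class_eqP eqR); rewrite Rsym; exact/negP.
Qed.

End Classes.

Section Connectivity.
Variables (V E : finType) (ends : E -> V * V).
Implicit Types (e f : E) (F : {set E}) (S : {set V}) (x y : V).

Definition conn (F : {set E}) (S : {set V}) : rel V := connect (adjD ends F S).

Definition comps (F : {set E}) (S : {set V}) : nat :=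
  #|classes (conn F S) (~: S)|.

Lemma omegaE S : omega ends S = comps setT S.
Proof. by []. Qed.

Lemma joins_sym e x y : joins ends e x y = joins ends e y x.
Proof. by rewrite /joins orbC. Qed.

Lemma joins_ends e : joins ends e (ends e).1 (ends e).2.
Proof. by rewrite /joins; case: (ends e) => a b /=; rewrite eqxx. Qed.

Lemma joinsP e x y : joins ends e x y ->
  x = (ends e).1 /\ y = (ends e).2 \/ x = (ends e).2 /\ y = (ends e).1.
Proof. by case/orP=> /eqP ->; [left|right]. Qed.

Lemma adjD_sym F S : symmetric (adjD ends F S).
Proof.
move=> x y; rewrite /adjD andbCA; congr [&& _, _ & _].
by apply: eq_existsb => e; rewrite joins_sym.
Qed.

Lemma conn_sym F S : symmetric (conn F S).
Proof.
suff sub x y : conn F S x y -> conn F S y x by move=> x y; apply/idP/idP=> /sub.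
case/connectP=> p; elim: p x => [|z p IHp] x /= => [_ ->|/andP[xz /IHp h] /h].
  exact: connect0.
by move=> c; apply: connect_trans c _; rewrite connect1 // adjD_sym.
Qed.

Lemma conn_equiv F S : equivalence_rel (conn F S).
Proof.
move=> x y z; split=> [|xy]; first exact: connect0.
apply/idP/idP; apply: connect_trans => //.
by have := xy; rewrite conn_sym.
Qed.

Lemma connxx F S x : conn F S x x. Proof. exact: connect0. Qed.

Lemma conn_trans F S : transitive (conn F S). Proof. exact: connect_trans. Qed.

Lemma conn_sub F F' S x y : F \subset F' -> conn F S x y -> conn F' S x y.
Proof.
move=> sF; apply: connect_sub => {}x {}y /and3P[xS yS /exists_inP[e eF j]].
by rewrite connect1 // /adjD xS yS; apply/exists_inP; exists e; rewrite ?(subsetP sF).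
Qed.

Lemma conn_edge F S e : e \in F -> (ends e).1 \notin S -> (ends e).2 \notin S ->
  conn F S (ends e).1 (ends e).2.
Proof.
move=> eF aS bS; rewrite /conn connect1 // /adjD aS bS.
by apply/exists_inP; exists e; rewrite ?joins_ends.
Qed.

Lemma conn_min F S (R : rel V) : equivalence_rel R ->
  (forall e, e \in F -> (ends e).1 \notin S -> (ends e).2 \notin S ->
     R (ends e).1 (ends e).2) ->
  forall x y, conn F S x y -> R x y.
Proof.
move=> eqR sub.
have Rxx x : R x x by have [] := eqR x x x.
have Rtr x y z : R x y -> R y z -> R x z by move=> xy; have [_ ->] := eqR x y z.
have Rsy x y : R x y -> R y x by move=> xy; have [_ <-] := eqR x y x.
move=> x y /connectP[p]; elim: p x => [|z p IHp] x /= => [_ ->//|].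
case/andP=> /and3P[xS zS /exists_inP[e eF /joinsP xz]] pth lst.
apply: Rtr (IHp z pth lst).
by case: xz xS zS => -[-> ->] aS bS; [|apply: Rsy]; apply: sub.
Qed.

Lemma conn_set0 S x y : conn set0 S x y = (x == y).
Proof.
apply/idP/eqP=> [|->]; last exact: connxx.
case/connectP=> -[|z p] //= /andP[/and3P[_ _ /exists_inP[e]]].
by rewrite inE.
Qed.

Lemma connU1 F S e x y : (ends e).1 \notin S -> (ends e).2 \notin S ->
  conn (e |: F) S x y = [|| conn F S x y,
    conn F S x (ends e).1 && conn F S (ends e).2 y
  | conn F S x (ends e).2 && conn F S (ends e).1 y].
Proof.
move=> aS bS; set a := (ends e).1; set b := (ends e).2.
have sF : F \subset e |: F := subsetUr _ _.
have eab : conn (e |: F) S a b by apply: conn_edge; rewrite ?setU11.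
apply/idP/idP=> [|/or3P[|/andP[xa yb]|/andP[xb ya]]]; last 3 first.
- exact: conn_sub.
- apply: conn_trans (conn_trans (conn_sub sF xa) eab) (conn_sub sF yb).
- rewrite conn_sym in eab.
  apply: conn_trans (conn_trans (conn_sub sF xb) eab) (conn_sub sF ya).
pose R u v := [|| conn F S u v, conn F S u a && conn F S b v
                | conn F S u b && conn F S a v].
apply: (@conn_min _ _ R) => [u v w|f].
  have tr := @conn_trans F S; have sy := conn_sym F S.
  rewrite /R connxx; split=> //; case/or3P=> [uv|/andP[ua bv]|/andP[ub av]].
  - have eqv t : conn F S u t = conn F S v t by have [_] := conn_equiv F S u v t; apply.
    by rewrite !eqv.
  - have eu t : conn F S u t = conn F S a t by have [_] := conn_equiv F S u a t; apply.
    have ev t : conn F S v t = conn F S b t.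
      by rewrite sy in bv; have [_] := conn_equiv F S v b t; apply.
    rewrite !eu !ev !connxx [conn F S b a]sy /=.
    by case: (conn F S a b) (conn F S a w) (conn F S b w) => [] [] [].
  - have eu t : conn F S u t = conn F S b t by have [_] := conn_equiv F S u b t; apply.
    have ev t : conn F S v t = conn F S a t.
      by rewrite sy in av; have [_] := conn_equiv F S v a t; apply.
    rewrite !eu !ev !connxx [conn F S b a]sy /=.
    by case: (conn F S a b) (conn F S a w) (conn F S b w) => [] [] [].
rewrite /R in_setU1 => /predU1P[->|fF] fa fb; first by rewrite !connxx orbT.
by rewrite conn_edge.
Qed.

Lemma connU1_del F S e x y : ~~ ((ends e).1 \notin S) || ~~ ((ends e).2 \notin S) ->
  conn (e |: F) S x y = conn F S x y.
Proof.
move=> eS; apply/idP/idP; last exact/conn_sub/subsetUr.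
apply: (conn_min (conn_equiv F S)) => f; rewrite in_setU1 => /predU1P[->|fF] aS bS.
  by rewrite aS bS in eS.
exact: conn_edge.
Qed.

Lemma comps_addedge F S e : comps F S <= (comps (e |: F) S).+1.
Proof.
have [/andP[aS bS]|nS] := boolP (((ends e).1 \notin S) && ((ends e).2 \notin S)).
  apply: classes_merge_le (conn_equiv _ _) (conn_equiv _ _) _ _ => x y.
  exact: connU1.
rewrite /comps (eq_classes (R' := conn F S)) // => x y.
by rewrite connU1_del -?negb_and.
Qed.

Lemma comps_add F F' S : comps F S <= comps (F' :|: F) S + #|F'|.
Proof.
have [n leF] := ubnP #|F'|; elim: n F' leF => // n IHn F' leF.
have [->|[e eF]] := set_0Vmem F'; first by rewrite set0U cards0 addn0.
have := IHn (F' :\ e); rewrite (cardsD1 e F') eF in leF *.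
move=> /(_ leF) /leq_trans-> //.
by rewrite add1n addnS -addSn leq_add2r -{2}(setD1K eF) -setUA comps_addedge.
Qed.

Lemma comps_set0 S : comps set0 S = #|~: S|.
Proof.
rewrite /comps /classes card_in_imset // => x y _ _ /setP/(_ y).
by rewrite !inE connxx conn_set0 => /eqP.
Qed.

Definition forest (F : {set E}) : Prop :=
  forall e, e \in F -> ~~ conn (F :\ e) set0 (ends e).1 (ends e).2.

Lemma sub_forest F F' : F' \subset F -> forest F -> forest F'.
Proof.
move=> sF fF e eF'; apply: contra (fF e (subsetP sF e eF')).
exact/conn_sub/setSD.
Qed.

Lemma card_rank F : #|V| <= comps F set0 + #|F|.
Proof. by have := comps_add set0 F set0; rewrite comps_set0 setU0 setC0 cardsT. Qed.

Lemma card_forest F : forest F -> #|V| = comps F set0 + #|F|.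
Proof.
have [n leF] := ubnP #|F|; elim: n F leF => // n IHn F leF fF.
have [->|[e eF]] := set_0Vmem F.
  by rewrite comps_set0 cards0 setC0 cardsT addn0.
rewrite (IHn (F :\ e)); last 2 first.
- by rewrite (cardsD1 e F) eF in leF.
- by apply: sub_forest fF; apply: subD1set.
rewrite (cardsD1 e F) eF add1n addnS -addSn; congr (_ + _).
rewrite -{2}(setD1K eF); apply: (@classes_merge _ _ _ (ends e).1 (ends e).2).
- exact: conn_equiv.
- exact: conn_equiv.
- by move=> x y; apply: connU1; rewrite inE.
- by rewrite !inE.
- by rewrite !inE.
- exact: fF.
Qed.

Lemma forestU1 F e : forest F -> ~~ conn F set0 (ends e).1 (ends e).2 ->
  forest (e |: F).
Proof.
move=> fF ne f; rewrite in_setU1 => /predU1P[->|fiF].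
  by apply: contra ne; apply: conn_sub; apply/subsetP=> g; rewrite !inE; case: eqP.
have [fe|nfe] := eqVneq f e.
  by subst f; rewrite (contra _ ne) //; apply: conn_sub; apply/subsetP=> g; rewrite !inE; case: eqP.
have -> : (e |: F) :\ f = e |: (F :\ f).
  by apply/setP=> g; rewrite !inE; case: (eqVneq g e) => [->|] //=; rewrite eq_sym nfe.
have sF : F :\ f \subset F by apply: subD1set.
rewrite connU1 ?inE // !negb_or fF //=.
have ef : conn F set0 (ends f).1 (ends f).2 by apply: conn_edge; rewrite ?inE.
have tr := @conn_trans F set0; have sy := conn_sym F set0.
apply/andP; split; apply: contra ne => /andP[/(conn_sub sF) h1 /(conn_sub sF) h2].
  by rewrite sy in h1; rewrite sy in h2; apply: tr (tr _ _ _ h1 ef) h2.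
by rewrite sy in h1; rewrite sy in ef; apply: tr (tr _ _ _ h2 ef) _; rewrite sy in h1.
Qed.

Lemma spanning_treeP F : 0 < #|V| -> forest F -> #|F|.+1 = #|V| ->
  spanning_tree ends F.
Proof.
move=> V0 fF cF; split=> // x y.
have := card_forest fF; rewrite -cF -add1n => /addIn/esym/eqP/cards1P[X defX].
have cl z : class (conn F set0) z = X.
  by apply/set1P; rewrite -defX imset_f // !inE.
by apply/(class_eqP (conn_equiv F set0)); rewrite !cl.
Qed.

End Connectivity.

(** * Decomposing sparse edge sets into forests *)

Section ClassSums.
Variables (T : finType) (R : rel T).
Hypothesis eqR : equivalence_rel R.

Lemma mem_class x : x \in class R x.
Proof. by rewrite inE; have [] := eqR x x x. Qed.

Lemma class_of_mem X x : X \in classes R setT -> x \in X -> class R x = X.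
Proof.
case/imsetP=> y _ ->; rewrite inE => Ryx.
by apply/esym/(class_eqP eqR).
Qed.

Lemma sum_classes (g : T -> nat) :
  \sum_(X in classes R setT) \sum_(x in X) g x = \sum_x g x.
Proof.
have -> : \sum_x g x = \sum_(x in [set: T]) g x by apply: eq_bigl => x; rewrite inE.
rewrite [RHS](partition_big_imset (class R)) /= -/(classes R _).
apply: eq_bigr => X XP; apply: eq_bigl => x; rewrite inE /=.
apply/idP/eqP => [xX|<-]; [exact: class_of_mem | exact: mem_class].
Qed.

Lemma card_classes_sum (I : finType) (A : {set I}) (h : I -> T) :
  #|A| = \sum_(X in classes R setT) #|[set i in A | h i \in X]|.
Proof.
rewrite -sum1_card.
rewrite (partition_big (class R \o h) (mem (classes R setT))) /=; last first.
  by move=> i _; apply: imset_f; rewrite inE.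
apply: eq_bigr => X XP; rewrite -sum1_card; apply: eq_bigl => i; rewrite !inE.
congr (_ && _); apply/eqP/idP => [<-|]; [exact: mem_class | exact: class_of_mem].
Qed.

End ClassSums.

Section NashWilliams.
Variables (V E : finType) (ends : E -> V * V).
Implicit Types (e f : E) (F B : {set E}) (S X : {set V}) (x y : V).

Definition ein B X : nat :=
  #|[set e in B | ((ends e).1 \in X) && ((ends e).2 \in X)]|.

Definition sparse m B : Prop :=
  forall X, X != set0 -> ein B X + m <= m * #|X|.

Lemma ein_sub B B' X : B \subset B' -> ein B X <= ein B' X.
Proof.
move=> sB; apply/subset_leq_card/subsetP=> e; rewrite !inE => /and3P[eB -> ->].
by rewrite (subsetP sB).
Qed.

Lemma sub_sparse m B B' : B \subset B' -> sparse m B' -> sparse m B.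
Proof.
by move=> sB spB X /spB; apply: leq_trans; rewrite leq_add2r ein_sub.
Qed.

(** The sparsity inequality is summed over the components of [B]; each edge of [B] lies inside one
    of them. *)
Lemma sparse_rank m B : sparse m B -> #|B| + m * comps ends B set0 <= m * #|V|.
Proof.
move=> spB; have eqR := conn_equiv ends B set0.
rewrite (card_classes_sum eqR B (fun e => (ends e).1)) /comps setC0.
rewrite mulnC -sum_nat_const -big_split /=.
have -> : m * #|V| = \sum_(X in classes (conn ends B set0) setT) m * #|X|.
  rewrite -big_distrr /= -cardsT -sum1_card; congr (m * _).
  rewrite (eq_bigl predT) => [|x]; last by rewrite inE.
  by rewrite -(sum_classes eqR); apply: eq_bigr => X _; rewrite sum1_card.
apply: leq_sum => X XP.
have X0 : X != set0.
  by case/imsetP: XP => x _ ->; apply/set0Pn; exists x; apply: mem_class.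
apply: leq_trans (spB X X0); rewrite leq_add2r; apply/subset_leq_card/subsetP=> e.
rewrite !inE => /andP[eB aX]; rewrite eB aX /=.
rewrite -(class_of_mem eqR XP aX) inE; apply: conn_edge; rewrite ?inE //.
Qed.

(* The unique path of a forest between two vertices consists of the edges whose
   removal separates them. *)
Lemma conn_path F (R : {set E}) x y : forest ends F -> conn ends F set0 x y ->
  (forall f, f \in F -> ~~ conn ends (F :\ f) set0 x y -> f \in R) ->
  conn ends (F :&: R) set0 x y.
Proof.
have [n] := ubnP #|F :\: R|; elim: n F => // n IHn F ltn fF Fxy sep.
have [FR|[f]] := set_0Vmem (F :\: R).
  by have -> : F :&: R = F by apply/setIidPl; rewrite -setD_eq0 FR.
rewrite inE => /andP[fR fF'].
have Ff : conn ends (F :\ f) set0 x y.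
  by apply: contraR fR => /(sep f fF').
have -> : F :&: R = (F :\ f) :&: R.
  by apply/setP=> g; rewrite !inE; case: eqVneq => // ->; rewrite (negPf fR) andbF.
apply: IHn => //.
- have -> : F :\ f :\: R = (F :\: R) :\ f by apply/setP=> g; rewrite !inE andbCA.
  by move: ltn; rewrite (cardsD1 f) !inE fR fF'.
- by apply: sub_forest fF; apply: subD1set.
move=> g /setD1P[gf gF] nc; apply: sep => //; apply: contra nc.
have -> : F :\ g = f |: (F :\ f :\ g).
  by apply/setP=> h; rewrite !inE; case: (eqVneq h f) => [->|]; rewrite // eq_sym gf.
have sFf : F :\ f :\ g \subset F :\ f by apply: subD1set.
have sy := conn_sym ends (F :\ f) set0; have tr := @conn_trans _ _ ends (F :\ f) set0.
rewrite connU1 ?inE // => /or3P[//||] /andP[/(conn_sub sFf) h1 /(conn_sub sFf) h2];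
  case/negP: (fF f fF'); rewrite sy in h1; rewrite sy in h2.
- exact: tr (tr _ _ _ h1 Ff) h2.
- by rewrite sy; apply: tr (tr _ _ _ h1 Ff) h2.
Qed.


(** * Augmenting a partial decomposition into forests *)

Section Recolouring.
Variables (m : nat) (B : {set E}).

Let state := ({ffun 'I_m -> {set E}} * E)%type.

(* [s.2] is the only uncoloured edge of [B]. *)
Definition partial_colouring (s : state) : Prop :=
  [/\ forall i, forest ends (s.1 i),
      forall i j, i != j -> [disjoint s.1 i & s.1 j]
    & forall f, f \in B :\ s.2 <-> exists i, f \in s.1 i].

(** The uncoloured edge [s.2] closes a cycle with the forest of colour [i]. It takes this colour
    from another edge [t.2] of the cycle, which becomes the uncoloured one. *)
Definition recolour : rel state := fun s t =>
  [exists i, [&& conn ends (s.1 i) set0 (ends s.2).1 (ends s.2).2,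
    t.2 \in s.1 i, s.2 \in B,
    ~~ conn ends (s.1 i :\ t.2) set0 (ends s.2).1 (ends s.2).2
  & t.1 == [ffun j => if j == i then s.2 |: (s.1 i :\ t.2) else s.1 j]]].

Lemma recolour_valid s t : recolour s t -> partial_colouring s ->
  partial_colouring t /\ t.2 \in B.
Proof.
case: s t => [T h] [T' h'] /existsP[i /and5P[/= hc h'T hB nc /eqP->]] [fT dT uT].
have hT j : h \notin T j.
  by apply/negP=> hT; have /= := (uT h).2 (ex_intro _ j hT); rewrite !inE eqxx.
have h'B : h' \in B :\ h by apply/uT; exists i.
split; last by move: h'B => /setD1P[].
have disj j : j != i -> [disjoint h |: (T i :\ h') & T j].
  move=> ji; rewrite -setI_eq0; apply/eqP/setP=> f; rewrite !inE; apply/negP=> /andP[/orP[/eqP->|/andP[_ fi]] fj].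
    by rewrite (negPf (hT j)) in fj.
  by have /pred0P/(_ f) := dT i j (contra_neq (@esym _ _ _) ji); rewrite /= fi fj.
split=> /= [j|j k jk|f]; rewrite ?ffunE.
- case: eqP => // _; apply: forestU1 => //; apply: sub_forest (fT i).
  exact: subD1set.
- case: (eqVneq j i) jk => [->|ji]; case: (eqVneq k i) => [ek|ki] jk //.
  + exact: disj.
  + by rewrite disjoint_sym; apply: disj.
  + exact: dT.
- split=> [/setD1P[fh' fB]|[j]].
    have [->|fh] := eqVneq f h; first by exists i; rewrite ffunE eqxx setU11.
    have /uT[j /= fj] : f \in B :\ h by rewrite !inE fh.
    exists j; rewrite ffunE; case: eqP fj => // -> fi.
    by rewrite !inE fh' fi orbT.
  rewrite ffunE; case: eqP => [_|/eqP ji].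
    rewrite !inE => /orP[/eqP->|/andP[-> fi]].
      by rewrite hB andbT; apply: contraTneq h'T => <-.
    by have /setD1P[] := (uT f).2 (ex_intro _ i fi).
  move=> fj; have /setD1P[_ fB] := (uT f).2 (ex_intro _ j fj).
  rewrite !inE fB andbT; apply: contraTneq fj => ->.
  by have /pred0P/(_ h') := dT i j (contra_neq (@esym _ _ _) ji); rewrite /= h'T /= => ->.
Qed.

End Recolouring.

Definition forest_partition m (B : {set E}) (T : 'I_m -> {set E}) : Prop :=
  [/\ forall i, forest ends (T i), forall i j, i != j -> [disjoint T i & T j]
    & forall f, f \in B <-> exists i, f \in T i].

(* If no recolouring frees an end of the uncoloured edge, every colour class
   spans the set [R] of the edges that can become uncoloured, so [R] has too
   many edges. *)
Lemma extend_colouring m B (s0 : {ffun 'I_m -> {set E}} * E) :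
  sparse m B -> s0.2 \in B -> partial_colouring B s0 ->
  exists T : 'I_m -> {set E}, forest_partition B T.
Proof.
move=> spB s0B valid0.
have validR s : connect (recolour B) s0 s -> partial_colouring B s /\ s.2 \in B.
  case/connectP=> p; elim/last_ind: p s => [|p t IHp] s /=; first by move=> _ ->.
  rewrite rcons_path last_rcons => /andP[pp st] ->.
  by have [vs sB] := IHp _ pp erefl; apply: recolour_valid st vs.
have [/existsP[s /andP[s0s /existsP[i nc]]]|stuck] :=
  boolP [exists s, connect (recolour B) s0 s &&
    [exists i, ~~ conn ends (s.1 i) set0 (ends s.2).1 (ends s.2).2]].
  have [[fT dT uT] sB] := validR s s0s.
  have hT j : s.2 \notin s.1 j.
    by apply/negP=> hT; have := (uT s.2).2 (ex_intro _ j hT); rewrite !inE eqxx.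
  exists (fun j => if j == i then s.2 |: s.1 i else s.1 j); split.
  - by move=> j; case: eqP => // _; apply: forestU1.
  - move=> j k; case: (eqVneq j i) => [->|ji]; case: (eqVneq k i) => [ek|ki] jk //.
    + by rewrite -setI_eq0 setIUl setU_eq0 !setI_eq0 disjoints1 hT dT // eq_sym.
    + by rewrite disjoint_sym -setI_eq0 setIUl setU_eq0 !setI_eq0 disjoints1 hT disjoint_sym dT.
    + exact: dT.
  - move=> f; split=> [fB|[j]].
      have [->|fh] := eqVneq f s.2; first by exists i; rewrite eqxx setU11.
      have /uT[j fj] : f \in B :\ s.2 by rewrite !inE fh.
      by exists j; case: eqP fj => // -> fi; rewrite !inE fi orbT.
    case: eqP => [_|_ fj]; last by have /setD1P[] := (uT f).2 (ex_intro _ j fj).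
    rewrite !inE => /orP[/eqP->//|fi].
    by have /setD1P[] := (uT f).2 (ex_intro _ i fi).
pose R := [set h | [exists T, connect (recolour B) s0 (T, h)]].
have joined s : connect (recolour B) s0 s -> forall i,
    conn ends (s.1 i) set0 (ends s.2).1 (ends s.2).2.
  move=> s0s i; apply: contraR stuck => nc; apply/existsP; exists s.
  by rewrite s0s; apply/existsP; exists i.
have joinedR s : connect (recolour B) s0 s -> forall i,
    conn ends (s.1 i :&: R) set0 (ends s.2).1 (ends s.2).2.
  move=> s0s i; have [[fT _ _] sB] := validR s s0s.
  apply: conn_path => [//||f fi nc]; first exact: joined.
  rewrite inE; apply/existsP.
  exists [ffun j => if j == i then s.2 |: (s.1 i :\ f) else s.1 j].
  apply: (connect_trans s0s); apply: connect1; apply/existsP; exists i.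
  by apply/and5P; split=> //=; apply: joined.
have inR s : connect (recolour B) s0 s -> s.2 \in R.
  by case: s => T h s0s; rewrite inE; apply/existsP; exists T.
(* A step in colour [k] exchanges two edges of a cycle all of whose edges lie in [R], so the trace
   of each colour on [R] keeps its components. *)
have invR s : connect (recolour B) s0 s -> forall i,
    conn ends (s.1 i :&: R) set0 =2 conn ends (s0.1 i :&: R) set0.
  move=> s0s; have /connectP[p] := s0s.
  elim/last_ind: p s s0s => [|p t IHp] s s0s /=; first by move=> _ ->.
  rewrite rcons_path last_rcons => /andP[pp st] est i x y.
  have s0u : connect (recolour B) s0 (last s0 p) by apply/connectP; exists p.
  rewrite -(IHp _ s0u pp erefl); set u := last s0 p in st s0u *.
  move: st; rewrite -{t}est => /existsP[k /and5P[_ h'k hB nc /eqP->]].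
  rewrite ffunE; case: eqP => // ->; set h := u.2 in hB nc *; set h' := s.2 in h'k nc *.
  set A := u.1 k :&: R; pose A0 := A :\ h'.
  have h'A : h' \in A by rewrite inE h'k inR.
  have eA : h' |: A0 = A by rewrite setD1K.
  have eA' : (h |: (u.1 k :\ h')) :&: R = h |: A0.
    apply/setP=> f; rewrite !(in_setI, in_setU1, in_setD1).
    by case: (eqVneq f h) => [->|_] /=; rewrite ?andbA // (inR u).
  have hA : conn ends A set0 (ends h).1 (ends h).2 by apply: joinedR.
  have h'A' : conn ends (h |: A0) set0 (ends h').1 (ends h').2.
    have nc0 : ~~ conn ends A0 set0 (ends h).1 (ends h).2.
      by apply: contra nc; apply: conn_sub; apply: setSD; apply: subsetIl.
    have sA : A0 \subset h |: A0 by apply: subsetUr.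
    have eh : conn ends (h |: A0) set0 (ends h).1 (ends h).2.
      by apply: conn_edge; rewrite ?in_set0 ?setU11.
    have tr := @conn_trans _ _ ends (h |: A0) set0.
    have sy := conn_sym ends (h |: A0) set0.
    move: hA; rewrite -eA connU1 ?in_set0 // (negPf nc0) /=.
    case/orP=> /andP[/(conn_sub sA) h1 /(conn_sub sA) h2].
      by rewrite sy in h1; rewrite sy in h2; apply: tr (tr _ _ _ h1 eh) h2.
    by rewrite sy; rewrite sy in h1; rewrite sy in h2; apply: tr (tr _ _ _ h1 eh) h2.
  rewrite eA'; apply/idP/idP; apply: conn_min (conn_equiv _ _ _) _ _ _ => f.
    rewrite in_setU1 in_setD1 => /orP[/eqP-> //|/andP[_ fA]] _ _.
    by apply: conn_edge; rewrite ?in_set0.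
  have [-> //|fh' fA _ _] := eqVneq f h'.
  by apply: conn_edge; rewrite ?in_set0 // in_setU1 in_setD1 fh' fA orbT.
have RB : R \subset B.
  by apply/subsetP=> h; rewrite inE => /existsP[T /validR[]].
have spanR i : comps ends (s0.1 i :&: R) set0 = comps ends R set0.
  rewrite /comps; congr #|pred_of_set _|; apply: eq_classes => x y; apply/idP/idP.
    exact/conn_sub/subsetIr.
  apply: conn_min (conn_equiv _ _ _) _ _ _ => h; rewrite inE => /existsP[T s0s] _ _.
  by rewrite -(invR _ s0s); apply: joinedR s0s i.
have [fT dT uT] := valid0.
(* The traces of the colours on [R] are disjoint and each has at least the rank of [R] many edges;
   the uncoloured edge, which is in none of them, makes the inequality strict. *)
have cardR : m * (#|V| - comps ends R set0) < #|R|.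
  rewrite (cardsD1 s0.2) inR ?connect0 // add1n ltnS.
  have -> : m * (#|V| - comps ends R set0) = \sum_(i < m) (#|V| - comps ends R set0).
    by rewrite sum_nat_const card_ord.
  apply: (@leq_trans (\sum_(i < m) #|s0.1 i :&: R|)).
    apply: leq_sum => i _; rewrite leq_subLR -(spanR i) addnC.
    by rewrite addnC; apply: card_rank.
  apply: (@leq_trans (\sum_(i < m) \sum_f (f \in s0.1 i :&: R))).
    by apply: leq_sum => i _; rewrite -sum1_card big_mkcond.
  rewrite exchange_big /= -sum1_card [leqRHS]big_mkcond /=; apply: leq_sum => f _.
  have [i fi|none] := pickP (fun i => f \in s0.1 i :&: R); last first.
    by rewrite big1 // => i _; rewrite none.
  rewrite (bigD1 i) //= big1 => [|j ji]; last first.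
    move: fi; rewrite !inE => /andP[fi _]; apply/eqP; rewrite eqb0.
    by have /pred0P/(_ f) := dT i j (contra_neq (@esym _ _ _) ji); rewrite /= fi /= => ->.
  move: (fi); rewrite !inE => /andP[fi' ->].
  by have /setD1P[-> _] := (uT f).2 (ex_intro _ i fi'); rewrite addn0 leq_b1.
have := sparse_rank (sub_sparse RB spB).
have : comps ends R set0 <= #|V|.
  by rewrite /comps setC0 -[leqRHS]cardsT; apply: leq_imset_card.
rewrite mulnBr in cardR; nia.
Qed.

(* The Nash-Williams arboricity theorem. *)
Theorem sparse_forests m B : sparse m B ->
  exists T : 'I_m -> {set E}, forest_partition B T.
Proof.
have [n] := ubnP #|B|; elim: n B => // n IHn B ltn spB.
have [->|[e eB]] := set_0Vmem B.
  exists (fun=> set0); split=> [i f|i j _|f]; rewrite ?inE ?disjoints_subset ?sub0set //.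
  by split=> [//|[i]] /=; rewrite ?inE.
have [||T [fT dT uT]] := IHn (B :\ e).
- by rewrite (cardsD1 e B) eB in ltn.
- by apply: sub_sparse spB; apply: subD1set.
apply: (@extend_colouring _ _ ([ffun i => T i], e)) => //.
split=> /= [i|i j|f]; rewrite ?ffunE; first exact: fT.
  exact: dT.
by rewrite uT; split=> -[i fi]; exists i; rewrite ffunE in fi *.
Qed.

(** Each of the [m] forests has at most [#|V| - 1] edges and together they have [m * (#|V| - 1)], so
    none falls short. *)
Theorem sparse_tree_connected m B F : 0 < #|V| -> sparse m B -> B \subset F ->
  #|B| + m = m * #|V| -> tree_connected ends m F.
Proof.
move=> V0 spB sBF cB; have [T [fT dT uT]] := sparse_forests spB.
have leT i : #|T i| < #|V|.
  have := card_forest (fT i); suff: 0 < comps ends (T i) set0 by lia.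
  have /card_gt0P[x _] := V0.
  apply/card_gt0P; exists (class (conn ends (T i) set0) x).
  by rewrite imset_f // !inE.
have sumT : #|B| <= \sum_(i < m) #|T i|.
  have -> : B = \bigcup_(i < m) T i.
    by apply/setP=> f; apply/idP/bigcupP=> [/uT[i fi]|[i _ fi]]; [exists i | apply/uT; exists i].
  elim/big_rec2: _ => [|i n A _ le]; first by rewrite cards0.
  by apply: leq_trans (leq_card_setU _ _) _; rewrite leq_add2l.
exists T; split=> [i|]; first by apply: subset_trans sBF; apply/subsetP=> f fi; apply/uT; exists i.
split=> // i; apply: spanning_treeP => //; apply/eqP.
rewrite eqn_leq leT /= leqNgt; apply/negP=> lti.
have : \sum_(j < m) #|T j|.+1 < \sum_(j < m) #|V|.
  rewrite (bigD1 i) //= [ltnRHS](bigD1 i) //= -addSn leq_add //.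
  by apply: leq_sum => j _; apply: leT.
rewrite sum_nat_const card_ord -cB.
under eq_bigr => j _ do rewrite -addn1.
by rewrite big_split /= sum_nat_const card_ord muln1 ltn_add2r ltnNge sumT.
Qed.

End NashWilliams.

(** * Tight vertex sets *)

Section Tight.
Variables (V E : finType) (ends : E -> V * V) (m : nat).
Implicit Types (e f : E) (F B C : {set E}) (S X Y A : {set V}) (x y : V).

Definition inside X e : bool := ((ends e).1 \in X) && ((ends e).2 \in X).

Definition tight B X : bool := (X != set0) && (ein ends B X + m == m * #|X|).

(* For a new edge [e] between [x] and [y], [e |: B] is sparse iff [~~ teq B x y]. *)
Definition teq B x y : bool := [exists X, [&& tight B X, x \in X & y \in X]].

Lemma einE B X : ein ends B X = #|[set e in B | inside X e]|.
Proof. by []. Qed.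

Lemma ein_super B X Y :
  ein ends B X + ein ends B Y <= ein ends B (X :|: Y) + ein ends B (X :&: Y).
Proof.
rewrite !einE -cardsUI leq_add ?subset_leq_card //;
  apply/subsetP=> e; rewrite !inE /inside !inE.
  by case/orP=> /and3P[-> -> ->]; rewrite ?orbT.
by case/andP=> /and3P[-> -> ->] /and3P[_ -> ->].
Qed.

Lemma einU B C X : [disjoint B & C] ->
  ein ends (B :|: C) X = ein ends B X + ein ends C X.
Proof.
move=> dBC; rewrite !einE -cardsUI.
have -> : [set e in B | inside X e] :&: [set e in C | inside X e] = set0.
  apply/setP=> e; rewrite !inE; apply/negP=> /andP[/andP[eB _] /andP[eC _]].
  by have /pred0P/(_ e) := dBC; rewrite /= eB eC.
by rewrite cards0 addn0; apply: eq_card => e; rewrite !inE andb_orl.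
Qed.

Lemma ein1 e X : ein ends [set e] X = inside X e.
Proof.
rewrite einE; case: (boolP (inside X e)) => h.
  by apply/eqP/cards1P; exists e; apply/setP=> f; rewrite !inE; case: eqVneq => // ->.
by apply/eqP; rewrite cards_eq0; apply/eqP/setP=> f; rewrite !inE; case: eqVneq => // ->; rewrite (negPf h).
Qed.

Lemma einU1 B e X : e \notin B -> ein ends (e |: B) X = inside X e + ein ends B X.
Proof. by move=> eB; rewrite einU ?ein1 // disjoints1. Qed.

Lemma einD1 B e X : e \in B -> ein ends B X = inside X e + ein ends (B :\ e) X.
Proof. by move=> eB; rewrite -{1}(setD1K eB) einU1 // !inE eqxx. Qed.

Lemma tight_neq0 B X : tight B X -> X != set0. Proof. by case/andP. Qed.

Lemma tightE B X : tight B X -> ein ends B X + m = m * #|X|.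
Proof. by case/andP=> _ /eqP. Qed.

Lemma sparse_set0 : sparse ends m set0.
Proof.
move=> X X0; rewrite einE (_ : [set e in _ | _] = set0) ?cards0.
  by rewrite add0n leq_pmulr // card_gt0.
by apply/setP=> e; rewrite !inE.
Qed.

(** [ein] is supermodular while [m * #|X|] is modular, so the slacks of the union and of the
    intersection add up to at most zero. *)
Lemma tight_UI B X Y : sparse ends m B -> tight B X -> tight B Y ->
  X :&: Y != set0 -> tight B (X :|: Y) && tight B (X :&: Y).
Proof.
move=> spB tX tY XY0.
have XYu : X :|: Y != set0.
  by apply: contraNneq XY0 => e; rewrite -subset0 -e subIset // subsetUl.
have := spB _ XY0; have := spB _ XYu; have := ein_super B X Y.
have := tightE tX; have := tightE tY; rewrite /tight XY0 XYu /=.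
have := cardsUI X Y; move: #|X :|: Y| #|X :&: Y| #|X| #|Y| => a b c d.
by move=> abcd *; apply/andP; split; apply/eqP; nia.
Qed.

Lemma tight1 B x : loopless ends -> tight B [set x].
Proof.
move=> ll; rewrite /tight cards1 muln1.
rewrite (_ : ein _ _ _ = 0) ?add0n ?eqxx ?andbT; first by apply/set0Pn; exists x; rewrite inE.
apply/eqP; rewrite cards_eq0; apply/eqP/setP=> e; rewrite !inE.
by apply/negP=> /and3P[_ /eqP a /eqP b]; have := ll e; rewrite a b eqxx.
Qed.

Lemma teqP B x y : reflect (exists X, [/\ tight B X, x \in X & y \in X]) (teq B x y).
Proof. by apply: (iffP existsP) => -[X /and3P h]; exists X => //; apply/and3P. Qed.

Lemma teq_tight B X x y : tight B X -> x \in X -> y \in X -> teq B x y.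
Proof. by move=> tX xX yX; apply/teqP; exists X. Qed.

Hypothesis ll : loopless ends.

Lemma teq_refl B x : teq B x x.
Proof. by apply: (teq_tight (tight1 B x ll)); rewrite inE. Qed.

Lemma teq_equiv B : sparse ends m B -> equivalence_rel (teq B).
Proof.
move=> spB x y z; split=> [|xy]; first exact: teq_refl.
have tr a b c : teq B a b -> teq B b c -> teq B a c.
  move=> /teqP[X [tX aX bX]] /teqP[Y [tY bY cY]].
  have /(tight_UI spB tX tY)/andP[tU _] : X :&: Y != set0.
    by apply/set0Pn; exists b; rewrite inE bX.
  by apply: (teq_tight tU); rewrite inE ?aX ?cY ?orbT.
have yx : teq B y x.
  by have /teqP[X [tX xX yX]] := xy; apply: (teq_tight tX).
by apply/idP/idP; apply: tr.
Qed.

Lemma teq_sym B x y : teq B x y = teq B y x.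
Proof. by apply: eq_existsb => X; rewrite [(x \in X) && _]andbC. Qed.

Lemma tight_sub_class B X x : tight B X -> x \in X -> X \subset class (teq B) x.
Proof. by move=> tX xX; apply/subsetP=> y yX; rewrite inE; apply: (teq_tight tX). Qed.

(** Tight sets through [x] are closed under union, so a largest one contains all the others and is
    the class. *)
Lemma class_tight B x : sparse ends m B -> tight B (class (teq B) x).
Proof.
move=> spB; have xx : (x \in [set x]) by rewrite inE.
have ex : exists n, [exists X, [&& tight B X, x \in X & #|X| == n]].
  by exists 1; apply/existsP; exists [set x]; rewrite tight1 // xx cards1.
have bd n : [exists X, [&& tight B X, x \in X & #|X| == n]] -> n <= #|V|.
  by case/existsP=> X /and3P[_ _ /eqP<-]; apply: max_card.
case: (ex_maxnP ex bd) => n /existsP[X /and3P[tX xX /eqP cX]] maxn.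
suff -> : class (teq B) x = X by [].
apply/eqP; rewrite eqEsubset tight_sub_class // andbT.
apply/subsetP=> y; rewrite inE => /teqP[Y [tY xY yY]].
have /(tight_UI spB tX tY)/andP[tU _] : X :&: Y != set0.
  by apply/set0Pn; exists x; rewrite inE xX.
have /maxn : [exists Z, [&& tight B Z, x \in Z & #|Z| == #|X :|: Y|]].
  by apply/existsP; exists (X :|: Y); rewrite tU inE xX /=.
rewrite -cX => le; have /eqP-> : X == X :|: Y by rewrite eqEcard subsetUl.
by rewrite inE yY orbT.
Qed.

Lemma tight_super B B' X : sparse ends m B' -> B \subset B' -> tight B X -> tight B' X.
Proof.
move=> spB' sB /andP[X0 /eqP tX]; rewrite /tight X0 eqn_leq spB' //=.
by rewrite -tX leq_add2r ein_sub.
Qed.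

Lemma teq_sub B B' x y : sparse ends m B' -> B \subset B' -> teq B x y -> teq B' x y.
Proof.
move=> spB' sB /teqP[X [tX xX yX]]; apply: (teq_tight _ xX yX).
exact: tight_super tX.
Qed.

Lemma sparseU1 B e : sparse ends m B -> ~~ teq B (ends e).1 (ends e).2 ->
  sparse ends m (e |: B).
Proof.
move=> spB nt X X0.
have [eB|eB] := boolP (e \in B).
  by rewrite (_ : e |: B = B) ?spB //; apply/setUidPr; rewrite sub1set.
rewrite einU1 //; have := spB X X0; case: (boolP (inside X e)) => // /andP[aX bX].
rewrite leq_eqVlt => /orP[tX|]; last by lia.
by case/negP: nt; apply: (@teq_tight B X) => //; rewrite /tight X0.
Qed.

(** * Replacing a sparse set inside a common tight set *)

Section Replacement.
Variables (B1 B2 B3 : {set E}) (A : {set V}).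
Hypothesis B3E : forall e, e \in B3 = if inside A e then e \in B1 else e \in B2.

Lemma ein_replace_sup X : A \subset X -> ein ends B3 A = ein ends B2 A ->
  ein ends B3 X = ein ends B2 X.
Proof.
have split B : A \subset X ->
    ein ends B X = ein ends B A + #|[set e in B | inside X e && ~~ inside A e]|.
  move=> AX; rewrite !einE -cardsUI.
  have -> : [set e in B | inside A e] :&: [set e in B | inside X e && ~~ inside A e] = set0.
    by apply/setP=> e; rewrite !inE; case: (inside A e); rewrite ?andbF.
  rewrite cards0 addn0; apply: eq_card => e; rewrite !inE.
  case: (boolP (inside A e)) => [/andP[a b]|]; rewrite ?andbF ?andbT ?orbF //=.
  by rewrite /inside !(subsetP AX) ?andbT.
move=> AX eA; rewrite !split // eA; congr (_ + _).
by apply: eq_card => e; rewrite !inE B3E; case: (inside A e); rewrite ?andbF.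
Qed.

Lemma ein_replace_disj X : X :&: A = set0 -> ein ends B3 X = ein ends B2 X.
Proof.
move=> XA0; apply: eq_card => e; rewrite !inE B3E; case: ifP => // /andP[aA _].
have aX : (ends e).1 \notin X.
  by apply/negP=> aX; have := in_set0 (ends e).1; rewrite -XA0 inE aX aA.
by rewrite (negPf aX) !andbF.
Qed.

Lemma ein_replace_sub X : X \subset A -> ein ends B3 X = ein ends B1 X.
Proof.
move=> XA; apply/eq_card=> e; rewrite !inE B3E /inside.
case: (boolP (_ \in X)) => aX; case: (boolP (_ \in X)) => bX; rewrite ?andbF //=.
by rewrite !(subsetP XA).
Qed.

Hypotheses (sp1 : sparse ends m B1) (sp2 : sparse ends m B2).
Hypotheses (t1 : tight B1 A) (t2 : tight B2 A).

Lemma replace_tight : tight B3 A.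
Proof. by rewrite /tight (tight_neq0 t1) -(tightE t1) ein_replace_sub ?eqxx. Qed.

Let eA : ein ends B3 A = ein ends B2 A.
Proof. by have := tightE replace_tight; have := tightE t2; lia. Qed.

Lemma replace_card : #|B3| = #|B2|.
Proof.
have := ein_replace_sup (subsetT _) eA; rewrite !einE.
have eT B : [set e in B | inside setT e] = B.
  by apply/setP=> e; rewrite !inE /inside !inE /= andbT.
by rewrite !eT.
Qed.

(** Only sets [X] that meet [A] are in question. There supermodularity reduces the count to
    [X :|: A], where [B3] has as many edges as [B2], and to [X :&: A], where [B3] coincides with
    [B1]. *)
Lemma replace_sparse : sparse ends m B3.
Proof.
move=> X X0; have [XA0|XA0] := eqVneq (X :&: A) set0.
  by rewrite ein_replace_disj //; apply: sp2.
have XuA : X :|: A != set0.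
  by apply: contraNneq X0 => e; rewrite -subset0 -e subsetUl.
have := sp2 XuA; have := sp1 XA0; have := ein_super B3 X A.
rewrite (@ein_replace_sub (X :&: A)) ?subsetIr //.
rewrite (@ein_replace_sup (X :|: A)) ?subsetUr //.
have := tightE replace_tight; have := cardsUI X A.
by move: #|X :|: A| #|X :&: A| #|X| #|A| => *; nia.
Qed.

Lemma replace_teq_sub x y : teq B2 x y -> teq B3 x y.
Proof.
move=> /teqP[X [tX xX yX]]; have [XA0|XA0] := eqVneq (X :&: A) set0.
  apply: (teq_tight _ xX yX).
  by rewrite /tight (tight_neq0 tX) -(tightE tX) ein_replace_disj ?eqxx.
have /andP[tU _] := tight_UI sp2 tX t2 XA0.
apply: (@teq_tight _ (X :|: A)); rewrite ?inE ?xX ?yX //.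
by rewrite /tight (tight_neq0 tU) -(tightE tU) ein_replace_sup ?subsetUr ?eqxx.
Qed.

End Replacement.

(** [B2] arises in turn from [B3] by a replacement inside [A], which reverses the inclusion of
    [replace_teq_sub]. *)
Lemma replace_teq B1 B2 B3 A :
  (forall e, e \in B3 = if inside A e then e \in B1 else e \in B2) ->
  sparse ends m B1 -> sparse ends m B2 -> tight B1 A -> tight B2 A ->
  teq B3 =2 teq B2.
Proof.
move=> B3E sp1 sp2 t1 t2 x y.
have sp3 := replace_sparse B3E sp1 sp2 t1 t2.
have t3 := replace_tight B3E t1.
apply/idP/idP; last exact: replace_teq_sub B3E _ _ _ _ _.
apply: (@replace_teq_sub B2 B3 B2 A) => // e.
by rewrite B3E; case: (inside A e).
Qed.

(** In the matroid of sparse sets, [f] is an element of [C] on the fundamental circuit of [e]. It is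
    found inside the smallest tight set [T] around [e]: with no edge of [C] there, [T] would stay
    tight in [B :\: C]. Every tight set around [e] contains [T], hence [f], so removing [f] makes
    room for [e]. *)
Lemma exchange B C e : sparse ends m B -> C \subset B -> e \notin B ->
  teq B (ends e).1 (ends e).2 -> ~~ teq (B :\: C) (ends e).1 (ends e).2 ->
  exists f, [/\ f \in C, teq B (ends f).1 (ends e).1 /\ teq B (ends f).2 (ends e).1,
    sparse ends m (e |: (B :\ f)) & teq (e |: (B :\ f)) =2 teq B].
Proof.
move=> spB sCB eB /existsP[X0 /and3P[tX0 aX0 bX0]] ntC.
pose P X := [&& tight B X, (ends e).1 \in X & (ends e).2 \in X].
have PX0 : P X0 by apply/and3P.
case: (arg_minnP (fun X : {set V} => #|X|) PX0) => T /and3P[tT aT bT] minT.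
have [f /andP[fC fT]|noC] := pickP (fun f => (f \in C) && inside T f); last first.
  case/negP: ntC; apply: (@teq_tight _ T) => //; rewrite /tight (tight_neq0 tT).
  rewrite -(tightE tT) eqn_add2r; apply/eqP/eq_card => f; rewrite !inE -/(inside T f).
  by have := noC f; case: (f \in C); case: (inside T f); rewrite //= !andbF.
have fB : f \in B by apply: (subsetP sCB).
have eBf : e \notin B :\ f by rewrite !inE negb_and eB orbT.
have ie : inside T e by rewrite /inside aT bT.
set B' := e |: (B :\ f).
have einB' X : ein ends B' X + inside X f = ein ends B X + inside X e.
  by rewrite einU1 // (einD1 X fB) addnC addnCA addnC.
have spB' : sparse ends m B'.
  move=> X Xn0; have := spB X Xn0; have := einB' X.
  case: (boolP (inside X e)) => [/andP[aX bX]|_]; last first.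
    by rewrite addn0 => <- le; apply: leq_trans le; rewrite leq_add2r leq_addr.
  case: (boolP (inside X f)) => [_ /addIn->//|nf].
  rewrite addn0 => ->; rewrite leq_eqVlt => /orP[tX|]; last by rewrite addn1 addSn.
  have tX' : tight B X by rewrite /tight Xn0.
  have I0 : X :&: T != set0 by apply/set0Pn; exists (ends e).1; rewrite inE aX.
  have /andP[_ tI] := tight_UI spB tX' tT I0.
  have /minT le : P (X :&: T) by rewrite /P tI !inE aX bX aT bT.
  case/negP: nf; have /eqP eT : X :&: T == T by rewrite eqEcard subsetIr.
  by move: fT; rewrite -eT /inside !inE => /andP[/andP[-> _] /andP[-> _]].
have tT' : tight B' T.
  rewrite /tight (tight_neq0 tT) -(tightE tT) eqn_add2r.
  by have := einB' T; rewrite fT ie => /addIn->; rewrite eqxx.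
have /andP[f1T f2T] := fT.
exists f; split=> //; first by split; apply: (teq_tight tT).
apply: (@replace_teq B' B B' T) => // g; case: ifP => // ng.
rewrite !inE; have [ge|_] := eqVneq g e; first by rewrite ge ie in ng.
by have [gf|//] := eqVneq g f; first by rewrite gf fT in ng.
Qed.

End Tight.

(** * Exchanges in a matching *)

Section Matchings.
Variables (V E : finType) (ends : E -> V * V) (m : nat).
Hypothesis ll : loopless ends.
Variables (F B0 : {set E}).
Hypotheses (B0F : B0 \subset F).
Implicit Types (e f : E) (B C M N : {set E}) (X Y A W : {set V}) (v x y : V).

Local Notation teq := (teq ends m).
Local Notation tight := (tight ends m).
Local Notation sparse := (sparse ends m).
Local Notation inside := (inside ends).

Definition inc e v : bool := ((ends e).1 == v) || ((ends e).2 == v).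

Definition covered M v : bool := [exists e in M, inc e v].

Definition matching M : Prop :=
  forall e f v, e \in M -> f \in M -> inc e v -> inc f v -> e = f.

Definition good M W : Prop :=
  [/\ forall e, e \in M -> e \notin F /\ inside W e, matching M & sparse (B0 :|: M)].

Lemma coveredP M v : reflect (exists2 e, e \in M & inc e v) (covered M v).
Proof. exact: exists_inP. Qed.

Lemma inc1 e : inc e (ends e).1. Proof. by rewrite /inc eqxx. Qed.
Lemma inc2 e : inc e (ends e).2. Proof. by rewrite /inc eqxx orbT. Qed.

Lemma incP e v : inc e v -> v = (ends e).1 \/ v = (ends e).2.
Proof. by case/orP=> /eqP->; [left|right]. Qed.

Lemma insideP A e : reflect (forall v, inc e v -> v \in A) (inside A e).
Proof.
apply: (iffP andP) => [[a b] v /incP[]->//|h].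
by rewrite !h ?inc1 ?inc2.
Qed.

Lemma good_notB0 M W e : good M W -> e \in M -> e \notin B0.
Proof. by case=> h _ _ /h[eF _]; apply: contra eF; apply: (subsetP B0F). Qed.

Lemma good_disj M W : good M W -> [disjoint B0 & M].
Proof.
move=> gM; rewrite -setI_eq0; apply/eqP/setP=> e; rewrite !inE andbC.
by apply/negP=> /andP[/(good_notB0 gM)/negPf->].
Qed.

Lemma good_sparse M W : good M W -> sparse (B0 :|: M). Proof. by case. Qed.

Lemma good_out M W e v : good M W -> inc e v -> v \notin W -> e \notin M.
Proof. by case=> h _ _ ev; apply: contra => /h[_ /insideP/(_ _ ev)]. Qed.

Definition agree A M N : Prop := forall e, ~~ inside A e -> (e \in N) = (e \in M).

(** The last clause concerns an edge whose ends have left [W]: it allows an edge that was set aside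
    to be put back after [M] has been changed into [N]. *)
Definition swaps W M N : Prop :=
  [/\ good N W, teq (B0 :|: N) =2 teq (B0 :|: M), #|N| = #|M|
    & forall e v, e \notin F -> inc e v -> v \notin W -> sparse (e |: (B0 :|: M)) ->
      sparse (e |: (B0 :|: N)) /\ teq (e |: (B0 :|: N)) =2 teq (e |: (B0 :|: M))].

Lemma swaps_trans W M N M' : swaps W M N -> swaps W N M' -> swaps W M M'.
Proof.
move=> [_ tMN cMN xMN] [gM' tN cN xN]; split=> // [x y||e v eF ev vW sp].
- by rewrite tN.
- by rewrite cN.
have [sp' t1] := xMN e v eF ev vW sp; have [sp'' t2] := xN e v eF ev vW sp'.
by split=> // x y; rewrite t2.
Qed.

Lemma swaps_local W M N A : good M W -> good N W -> tight (B0 :|: M) A ->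
  tight (B0 :|: N) A -> agree A M N -> swaps W M N.
Proof.
move=> gM gN tM tN ag; have spM := good_sparse gM; have spN := good_sparse gN.
have B3E e : e \in B0 :|: N = if inside A e then e \in B0 :|: N else e \in B0 :|: M.
  by case: ifP => // /negbT nA; rewrite !inE ag.
split=> //.
- exact: replace_teq B3E spN spM tN tM.
- have := replace_card B3E tN tM; rewrite !cardsU.
  move: (good_disj gM) (good_disj gN); rewrite -!setI_eq0 => /eqP-> /eqP->.
  by rewrite cards0; lia.
move=> e v eF ev vW sp; have eM := good_out gM ev vW; have eN := good_out gN ev vW.
have eB : e \notin B0 by apply: contra eF; apply: (subsetP B0F).
have enB : e \notin B0 :|: M by rewrite inE negb_or eB.
have eA : ~~ inside A e.
  apply/negP=> eA; have := sp A (tight_neq0 tM).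
  by rewrite einU1 // eA; have := tightE tM; lia.
have tM' : tight (e |: (B0 :|: M)) A by apply: tight_super tM => //; apply: subsetUr.
have B3E' f : f \in e |: (B0 :|: N) =
    if inside A f then f \in B0 :|: N else f \in e |: (B0 :|: M).
  rewrite in_setU1; case: ifP => [fA|/negbT nA].
    by case: eqP fA => // ->; rewrite (negPf eA).
  by rewrite [in RHS]in_setU1 !inE ag.
by split; [apply: replace_sparse B3E' spN sp tN tM' | apply: replace_teq B3E' spN sp tN tM'].
Qed.

(** The matching can be changed so as to uncover [v], inside the tight class of [v] only. This
    confinement is what lets two vertices of different classes be uncovered at once. *)
Definition free M W v : Prop := exists N,
  let A := class (teq (B0 :|: M)) v in
  [/\ good N W, ~~ covered N v, tight (B0 :|: N) A & agree A M N].

(** The two changes take place in disjoint classes, so [N] can follow [My] inside [Ay] and [Mx]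
    elsewhere. *)
Lemma free_pair M W x y : good M W -> free M W x -> free M W y ->
  ~~ teq (B0 :|: M) x y ->
  exists N, [/\ swaps W M N, ~~ covered N x, ~~ covered N y
    & forall e, ~~ inside (class (teq (B0 :|: M)) x) e ->
        ~~ inside (class (teq (B0 :|: M)) y) e -> (e \in N) = (e \in M)].
Proof.
move=> gM [Mx [gx cx tx ax]] [My [gy cy ty ay]] nxy.
set Ax := class _ x in tx ax *; set Ay := class _ y in ty ay *.
have spM := good_sparse gM; have eqM := teq_equiv ll spM.
have swx : swaps W M Mx by apply: swaps_local gx _ _ ax => //; apply: class_tight.
have dis v : v \in Ax -> v \notin Ay.
  rewrite !inE => xv; apply: contra nxy => yv.
  by have [_ ->] := eqM x v y; rewrite // teq_sym.
have [_ teqx cardx _] := swx.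
have tyx : tight (B0 :|: Mx) Ay.
  have -> : Ay = class (teq (B0 :|: Mx)) y by apply/setP=> v; rewrite !inE teqx.
  exact/class_tight/good_sparse/gx.
have xx : x \in Ax := mem_class eqM x; have yy : y \in Ay := mem_class eqM y.
pose N := [set e | if inside Ay e then e \in My else e \in Mx].
have NE e : e \in B0 :|: N = if inside Ay e then e \in B0 :|: My else e \in B0 :|: Mx.
  by rewrite !inE; case: ifP.
(* An edge with just one end in [Ay] is inside neither class, and there [Mx], [My] and [M] agree. So
   at the vertices of [Ay] the set [N] is part of [My], and at the others it is part of [Mx]; it is
   a matching. *)
have Ny e v : e \in N -> inc e v -> v \in Ay -> e \in My.
  rewrite inE; case: ifP => // /negbT nAy ex ev vAy.
  rewrite ay // -ax //; apply/negP=> /insideP/(_ _ ev)/dis.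
  by rewrite vAy.
have Nx e v : e \in N -> inc e v -> v \notin Ay -> e \in Mx.
  by rewrite inE; case: ifP => // /insideP h _ /h->.
have spN : sparse (B0 :|: N).
  exact: replace_sparse NE (good_sparse gy) (good_sparse gx) ty tyx.
have gN : good N W.
  have [inx mx _] := gx; have [iny my _] := gy.
  split=> // [e|e f v eN fN ev fv]; first by rewrite inE; case: ifP => _; [apply: iny|apply: inx].
  have [vA|vA] := boolP (v \in Ay).
    exact: my (Ny _ _ eN ev vA) (Ny _ _ fN fv vA) ev fv.
  exact: mx (Nx _ _ eN ev vA) (Nx _ _ fN fv vA) ev fv.
exists N; split.
- apply: swaps_trans swx _; apply: (swaps_local gx gN tyx).
    exact: replace_tight NE ty.
  by move=> e nAy; rewrite inE (negPf nAy).
- by apply: contra cx => /coveredP[e eN ex]; apply/coveredP; exists e => //; apply: Nx eN ex (dis _ xx).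
- by apply: contra cy => /coveredP[e eN ey]; apply/coveredP; exists e => //; apply: Ny eN ey yy.
- by move=> e nx ny; rewrite inE (negPf ny) ax.
Qed.

(** * Setting aside one matching edge together with its ends *)

Section Peel.
Variables (M : {set E}) (W : {set V}) (e0 : E).
Hypotheses (gM : good M W) (e0M : e0 \in M).

Let W' := W :\: [set v | inc e0 v].
Let M' := M :\ e0.

Lemma good_peel : good M' W'.
Proof.
have [iM mM spM] := gM; split.
- move=> e /setD1P[ee0 eM]; have [eF eW] := iM e eM; split=> //.
  apply/insideP=> v ev; rewrite !inE (insideP _ _ eW) // andbT.
  by apply: contra_neqN ee0 => e0v; apply: mM ev e0v.
- by move=> e f v /setD1P[_ eM] /setD1P[_ fM]; apply: mM.
- by apply: sub_sparse spM; apply/setUS/subD1set.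
Qed.

Let e0F : e0 \notin F. Proof. by have [/(_ _ e0M)[]] := gM. Qed.
Let e0W' : (ends e0).1 \notin W'. Proof. by rewrite !inE inc1. Qed.

Let eBM : e0 |: (B0 :|: M') = B0 :|: M.
Proof. by rewrite setUCA setD1K. Qed.

Lemma unpeel N : swaps W' M' N -> [/\ good (e0 |: N) W,
  teq (B0 :|: (e0 |: N)) =2 teq (B0 :|: M) & forall v, v \in W' -> ~~ covered N v -> ~~ covered (e0 |: N) v].
Proof.
move=> [gN _ _ /(_ e0 _ e0F (inc1 e0) e0W')]; rewrite eBM => /(_ (good_sparse gM))[spN tN].
have [iM mM spM] := gM; have [iN mN _] := gN.
have noe0 e v : e \in N -> inc e v -> ~~ inc e0 v.
  by move=> /iN[_ /insideP h] /h; rewrite !inE => /andP[].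
rewrite setUCA; split=> //.
- split; last by rewrite setUCA.
  + move=> e /setU1P[->|/iN[eF /insideP h]]; first exact: iM.
    by split=> //; apply/insideP=> v /h /setDP[].
  + move=> e f v /setU1P[->|eN] /setU1P[->|fN] ev fv //.
    * by have := noe0 f v fN fv; rewrite ev.
    * by have := noe0 e v eN ev; rewrite fv.
    * exact: mN ev fv.
- move=> v vW' ncv; apply: contra ncv => /coveredP[e /setU1P[->|eN] ev].
    by move: vW'; rewrite !inE ev.
  by apply/coveredP; exists e.
Qed.

Lemma class_peel v : class (teq (B0 :|: M')) v \subset class (teq (B0 :|: M)) v.
Proof.
apply/subsetP=> u; rewrite !inE; apply: teq_sub; first exact: good_sparse gM.
exact/setUS/subD1set.
Qed.

Lemma inside_sub A A' e : A \subset A' -> inside A e -> inside A' e.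
Proof. by move=> sA /insideP h; apply/insideP=> v /h; apply: (subsetP sA). Qed.

Lemma free_unpeel v : v \in W' -> free M' W' v -> free M W v.
Proof.
move=> vW' [N [gN cN tN aN]]; have gM' := good_peel.
have sw : swaps W' M' N.
  by apply: swaps_local gN _ tN aN => //; apply/class_tight/good_sparse/gM'.
have [g t c] := unpeel sw; exists (e0 |: N); split=> //; first exact: c.
  have -> : class (teq (B0 :|: M)) v = class (teq (B0 :|: (e0 |: N))) v.
    by apply/setP=> u; rewrite !inE t.
  by apply/class_tight/good_sparse/g.
move=> e nin; rewrite in_setU1 aN ?in_setD1.
  by case: eqVneq => // ->.
by apply: contra nin; apply/inside_sub/class_peel.
Qed.

(* If both ends of [e] were free after peeling and in different classes, [e]
   could take the place of [e0], so both ends of [e0] would be free. *)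
Lemma peel_teq e v0 : inc e0 v0 -> ~ free M W v0 -> e \notin F -> e \notin M ->
  inside W' e -> (forall x, inc e x -> free M' W' x) ->
  teq (B0 :|: M) (ends e).1 (ends e).2 -> teq (B0 :|: M') (ends e).1 (ends e).2.
Proof.
move=> e0v0 nfree eF eM eW' fr te; apply: contraT => nte; case: nfree.
have gM' := good_peel.
have [N [sw cx cy aN]] := free_pair gM' (fr _ (inc1 e)) (fr _ (inc2 e)) nte.
have [gN tN _ _] := sw; have [g t _] := unpeel sw.
have eN : e \notin N.
  by apply: contra cx => eN; apply/coveredP; exists e => //; apply: inc1.
have e0N : e0 \notin N by apply: good_out gN (inc1 e0) e0W'.
have e0B0 : e0 \notin B0 by apply: contra e0F; apply: (subsetP B0F).
have eB0 : e \notin B0 by apply: contra eF; apply: (subsetP B0F).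
have ee0 : e != e0 by apply: contraNneq eM => ->.
have eB : e \notin B0 :|: (e0 |: N) by rewrite !inE !negb_or eB0 ee0.
have BD : (B0 :|: (e0 |: N)) :\: [set e0] = B0 :|: N.
  rewrite setDUl setU1K //; congr (_ :|: _); apply/setP=> f; rewrite !inE.
  by case: eqVneq => // ->; rewrite (negPf e0B0).
(* Without [e0] the ends of [e] are in different classes, so the circuit that [e] closes contains
   [e0]. *)
have [|||f [/set1P-> [te1 te2] spN tN']] := @exchange _ _ ends m _ [set e0] e (good_sparse g) _ eB.
- by rewrite sub1set !inE eqxx orbT.
- by rewrite t.
- by rewrite BD tN.
rewrite BD setUCA in spN tN'.
have ev0 : teq (B0 :|: M) v0 (ends e).1.
  by rewrite -t; case/incP: e0v0 => ->.
have eqM := teq_equiv ll (good_sparse gM).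
have tr a b c : teq (B0 :|: M) a b -> teq (B0 :|: M) b c -> teq (B0 :|: M) a c.
  by move=> ab bc; have [_ ->] := eqM a b c.
have [iN mN _] := gN; have [iM _ _] := gM.
have ncN x : inc e x -> ~~ covered N x by case/incP=> ->.
exists (e |: N); split.
- split=> //.
    move=> f' /setU1P[->|/iN[fF /insideP h]]; split=> //; apply/insideP=> x.
      by move/(insideP _ _ eW')/setDP=> [].
    by move/h/setDP=> [].
  move=> f1 f2 x /setU1P[->|f1N] /setU1P[->|f2N] xf1 xf2 //; last exact: mN xf1 xf2.
    by case/negP: (ncN _ xf1); apply/coveredP; exists f2.
  by case/negP: (ncN _ xf2); apply/coveredP; exists f1.
- apply/negP=> /coveredP[f' /setU1P[->|/iN[_ /insideP h]]].
    by move/(insideP _ _ eW'); rewrite !inE e0v0.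
  by move/h; rewrite !inE e0v0.
- have -> : class (teq (B0 :|: M)) v0 = class (teq (B0 :|: (e |: N))) v0.
    by apply/setP=> u; rewrite !inE tN' t.
  exact: class_tight.
move=> f'; set A := class _ v0 => nin.
have sub x : teq (B0 :|: M) v0 x -> class (teq (B0 :|: M')) x \subset A.
  move=> v0x; apply/subsetP=> u /(subsetP (class_peel x)); rewrite !inE.
  exact: tr.
have ins x : teq (B0 :|: M) v0 x -> ~~ inside (class (teq (B0 :|: M')) x) f'.
  by move=> v0x; apply: contra nin; apply/inside_sub/sub.
rewrite in_setU1 aN ?ins //; last exact: tr ev0 te.
have v0A : v0 \in A := mem_class eqM v0.
have [fe|fe] /= := eqVneq f' e.
  case/negP: nin; rewrite fe /inside/= inE ev0 inE; exact: tr ev0 te.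
rewrite in_setD1; have [fe0|//] := eqVneq f' e0.
case/negP: nin; rewrite fe0; apply/insideP=> z /incP[]->; rewrite inE.
  by apply: tr ev0 _; rewrite teq_sym -t.
by apply: tr ev0 _; rewrite teq_sym -t.
Qed.

End Peel.

(** As long as some vertex of [W] is not free, it is covered by [M], which would otherwise witness
    its freeness itself; the edge covering it is set aside with its ends. The edges set aside form
    [M :\: N], and [peel_teq] carries the second claim through each round. *)
Lemma saturated_core M W : good M W -> exists N, [/\ N \subset M,
  forall v, v \in W -> ~~ covered (M :\: N) v -> free M W v
& forall e, e \notin F -> e \notin M -> inside W e ->
    (forall v, inc e v -> ~~ covered (M :\: N) v) ->
    teq (B0 :|: M) (ends e).1 (ends e).2 -> teq (B0 :|: N) (ends e).1 (ends e).2].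
Proof.
have [n] := ubnP #|M|; elim: n M W => // n IHn M W ltn gM.
have [allfree|nall] := classic (forall v, v \in W -> free M W v).
  by exists M; split=> // v vW _; apply: allfree.
have [v0 nv0] := not_all_ex_not _ _ nall.
have [v0W nfree] := imply_to_and _ _ nv0.
have [/coveredP[e0 e0M e0v0]|ncov] := boolP (covered M v0); last first.
  case: nfree; exists M; split=> //; exact/class_tight/good_sparse/gM.
have [|N [sN frN tN]] := IHn (M :\ e0) _ _ (good_peel gM e0M).
  by rewrite (cardsD1 e0 M) e0M in ltn.
have NM : N \subset M := subset_trans sN (subD1set _ _).
have e0N : e0 \notin N by apply/negP=> /(subsetP sN); rewrite !inE eqxx.
have nc v : ~~ covered (M :\: N) v -> ~~ inc e0 v /\ ~~ covered (M :\ e0 :\: N) v.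
  move=> nc; split.
    by apply: contra nc => h; apply/coveredP; exists e0; rewrite // inE e0N.
  apply: contra nc => /coveredP[e /setDP[/setD1P[_ eM] eN] ev].
  by apply/coveredP; exists e; rewrite // inE eN.
exists N; split=> // [v vW /nc[ni nc']|e eF eM eW nce te].
  by apply: (free_unpeel gM e0M); [rewrite !inE ni | apply: frN; rewrite // !inE ni].
have eW' : inside (W :\: [set v | inc e0 v]) e.
  apply/insideP=> v ev; have [ni _] := nc v (nce v ev).
  by rewrite !inE ni (insideP _ _ eW).
apply: tN => //; first by rewrite !inE (negPf eM) andbF.
  by move=> v /nce/nc[].
apply: (peel_teq gM e0M e0v0 nfree) => // x ex.
have [ni nc'] := nc x (nce x ex).
by apply: frN => //; apply: (insideP _ _ eW').
Qed.

(** An available edge not spanned by [B0 :|: M] has free ends in different classes. [free_pair]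
    uncovers both without changing the spanned pairs, after which the edge can be added; this
    enlarges [M], so it stops. *)
Lemma blocked_matching W : sparse B0 -> exists M N, [/\ good M W, N \subset M
  & forall e, e \notin F -> inside W e ->
    (forall v, inc e v -> ~~ covered (M :\: N) v) ->
    e \in N \/ teq (B0 :|: N) (ends e).1 (ends e).2].
Proof.
move=> sp0; have : good set0 W.
  by split=> [e|e f v|]; rewrite ?inE // setU0.
have [n] := ubnP (#|E| - #|@set0 E|); elim: n (set0 : {set E}) => // n IHn M ltn gM.
have [N [NM fr tN]] := saturated_core gM.
pose bad e := [&& e \notin F, e \notin M, inside W e,
  [forall v, inc e v ==> ~~ covered (M :\: N) v]
  & ~~ teq (B0 :|: M) (ends e).1 (ends e).2].
have [e /and5P[eF eM eW /forallP nce nte]|nobad] := pickP bad; last first.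
  exists M, N; split=> // e eF eW nce.
  have [eM|eM] := boolP (e \in M).
    left; apply: contraT => eN; case/negP: (nce _ (inc1 e)); apply/coveredP.
    by exists e; rewrite ?inc1 // inE eN.
  right; apply: tN => //; have := nobad e; rewrite /bad eF eM eW /=.
  have -> /= : [forall v, inc e v ==> ~~ covered (M :\: N) v].
    by apply/forallP=> v; apply/implyP; apply: nce.
  by move/negbFE.
have fre v : inc e v -> free M W v.
  move=> ev; apply: fr; first exact: (insideP _ _ eW).
  by have /implyP := nce v; apply.
have [M2 [[g2 t2 c2 _] cx cy _]] := free_pair gM (fre _ (inc1 e)) (fre _ (inc2 e)) nte.
have eM2 : e \notin M2.
  by apply: contra cx => eN; apply/coveredP; exists e => //; apply: inc1.
have c3 : #|e |: M2| = #|M|.+1 by rewrite cardsU1 eM2 c2.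
have ltM : #|M| < #|E| by rewrite -c3 max_card.
apply: (IHn (e |: M2)).
  by rewrite c3 -ltnS; apply: leq_trans ltn; rewrite ltnS ltn_sub2l.
have [i2 m2 s2] := g2; split.
- by move=> f /setU1P[->|/i2].
- have ncN x : inc e x -> ~~ covered M2 x by case/incP=> ->.
  move=> f1 f2 x /setU1P[->|f1N] /setU1P[->|f2N] xf1 xf2 //; last exact: m2 xf1 xf2.
    by case/negP: (ncN _ xf1); apply/coveredP; exists f2.
  by case/negP: (ncN _ xf2); apply/coveredP; exists f1.
- by rewrite setUCA; apply: sparseU1 => //; rewrite t2.
Qed.

End Matchings.

(** * Completing a factor by a matching *)

(** [gs] and [d] count the good parts that survive the deletion and those that are swallowed by it;
    [gg] and [gb] count the edges of [B1] joining two good parts and a good part to another one. *)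
Lemma count_contradiction m r gs d s s' gg gb sD i : 0 < m -> 2 * m <= r ->
  2 * gg + gb + s + 2 * m + 2 <= 2 * m * (gs + d) ->
  r.+1 * d <= sD + 1 + gg -> 2 * sD <= s + 2 * i -> (d = 0 \/ i + m <= m * d) ->
  2 * m * r * gs <= (r.+1 - 2 * m) * s' + 2 * m * r -> s' <= s + 1 + gg + gb ->
  False.
Proof.
move=> m0 mr; have [q [k [k0 -> qE]]] : exists q k, [/\ 0 < k, r = k + q & q.+1 = 2 * m].
  by exists (2 * m).-1, (r.+1 - 2 * m); split; lia.
have -> : (k + q).+1 - 2 * m = k by lia.
move=> h1 h2 h3 h4 h5 h6.
have a1 : (k + q) * (2 * gg + gb + s + 2 * m + 2) <= (k + q) * (2 * m * (gs + d)).
  by rewrite leq_mul2l h1 orbT.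
have a2 : k * s' <= k * (s + 1 + gg + gb) by rewrite leq_mul2l h6 orbT.
(* [r] times [h1] is compared with the toughness bound [h5]; the two terms [2 * m * r] cancel. *)
have a3 : k * gg + k + q * (2 * gg + gb + s + 2) <= 2 * m * (k + q) * d by lia.
have [d0|im] := h4; first by rewrite d0 in a3; lia.
(* Twice [h2], combined with [h3] and [h4]; the constant [2 - 2 * m] is not positive. *)
have a4 : 2 * (k + m) * d <= s + 2 * gg by lia.
have a5 : q * (2 * (k + m) * d) <= q * (s + 2 * gg) by rewrite leq_mul2l a4 orbT.
(* This amounts to [m <= q], where [q = 2 * m - 1]. *)
have a6 : m * (k + q) <= q * (k + m).
  have [m' em] : exists m', m = m'.+1 by exists m.-1; lia.
  have -> : q = 2 * m' + 1 by lia.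
  rewrite em; lia.
have a7 : m * (k + q) * d <= q * (k + m) * d by rewrite leq_mul2r a6 orbT.
lia.
Qed.

Lemma sum_mem_sub (T : finType) (X C : {set T}) : X \subset C ->
  \sum_(e in C) (e \in X) = #|X|.
Proof.
move=> sX; rewrite -sum1_card -big_mkcondr /=; apply: eq_bigl => e.
by case: (boolP (e \in X)) => [/(subsetP sX)->|]; rewrite ?andbF.
Qed.

Lemma sum_fiber (I T : finType) (h : I -> T) (Z : pred I) (A : {set T}) :
  \sum_(x in A) #|[set i | Z i & h i == x]| = #|[set i | Z i & h i \in A]|.
Proof.
rewrite -[RHS]sum1_card (partition_big h (mem A)) /=; last first.
  by move=> i; rewrite inE => /andP[].
apply: eq_bigr => x xA; rewrite -sum1_card; apply: eq_bigl => i; rewrite !inE.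
by case: eqP => [->|]; rewrite ?xA ?andbT ?andbF.
Qed.

Section SubclassSums.
Variables (T : finType) (R : rel T).
Hypothesis eqR : equivalence_rel R.

Lemma sum_subclasses (D : {set {set T}}) (g : T -> nat) : D \subset classes R setT ->
  \sum_(A in D) \sum_(x in A) g x = \sum_(x | class R x \in D) g x.
Proof.
move=> sD; rewrite [RHS](partition_big (class R) (mem D)) //=.
apply: eq_bigr => A AD; apply: eq_bigl => x; have AP := subsetP sD A AD.
apply/idP/andP=> [xA|[_ /eqP<-]]; last exact: mem_class.
by rewrite (class_of_mem eqR AP xA) AD.
Qed.

End SubclassSums.

Section Counting.
Variables (V E : finType) (ends : E -> V * V).
Hypothesis ll : loopless ends.
Implicit Types (e f : E) (B C D : {set E}) (A Y : {set V}) (x v : V).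

Definition cut B A : nat := #|[set e in B | ((ends e).1 \in A) != ((ends e).2 \in A)]|.

Lemma sum_eq_mem A x : \sum_(v in A) (x == v) = (x \in A).
Proof.
rewrite -big_mkcondr /= sum1_card; case: (boolP (x \in A)) => xA.
  rewrite (eq_card (B := pred1 x)) ?card1 // => v; rewrite !inE [v == x]eq_sym.
  by rewrite unfold_in; case: eqP => [<-|]; rewrite ?xA ?andbF ?andbT.
by rewrite eq_card0 // => v; rewrite !inE; apply/negP=> /andP[vA /eqP e1]; rewrite e1 vA in xA.
Qed.

Lemma sum_deg B A : \sum_(v in A) deg ends B v = 2 * ein ends B A + cut B A.
Proof.
have -> : \sum_(v in A) deg ends B v =
    \sum_(e in B) (((ends e).1 \in A) + ((ends e).2 \in A)).
  under eq_bigr => v _ do rewrite /deg -sum1_card big_mkcond /=.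
  rewrite exchange_big /= [RHS]big_mkcond /=; apply: eq_bigr => e _.
  under eq_bigr => v _ do rewrite inE.
  case: (boolP (e \in B)) => eB /=; last by rewrite big1.
  have -> : ((ends e).1 \in A) + ((ends e).2 \in A) =
      \sum_(v in A) (((ends e).1 == v) + ((ends e).2 == v)).
    by rewrite big_split /= !sum_eq_mem.
  apply: eq_bigr => v _; have := ll e.
  by case: (eqVneq (ends e).1 v) => [->|_]; case: (eqVneq (ends e).2 v).
rewrite /ein /cut -!sum1_card !big_distrr /= !(big_mkcond (fun e => e \in finset _)) /=.
rewrite -big_split /= big_mkcond; apply: eq_bigr => e _; rewrite !inE.
by case: (e \in B); case: (_ \in A); case: (_ \in A).
Qed.

Lemma sum_deg_total B : \sum_v deg ends B v = 2 * #|B|.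
Proof.
have -> : \sum_v deg ends B v = \sum_(v in [set: V]) deg ends B v.
  by apply: eq_bigl => v; rewrite inE.
rewrite sum_deg; have -> : cut B setT = 0.
  by apply/eqP; rewrite cards_eq0; apply/eqP/setP=> e; rewrite !inE andbF.
rewrite addn0; congr (2 * _); apply: eq_card => e; rewrite !inE.
by rewrite /= andbT.
Qed.

Lemma cut_setC B A : cut B (~: A) = cut B A.
Proof.
apply: eq_card => e; rewrite !inE.
by case: (e \in B); case: (_ \in A); case: (_ \in A).
Qed.

Definition simple : Prop := forall e f x y, joins ends e x y -> joins ends f x y -> e = f.

Lemma ein_simple B A : simple -> 2 * ein ends B A <= #|A| * #|A|.-1.
Proof.
move=> simp; have -> : #|A| * #|A|.-1 = 2 * 'C(#|A|, 2).
  by have := bin_ffact #|A| 2; rewrite ffactnS ffactn1 => <-; rewrite mulnC.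
rewrite leq_mul2l /= -cards_draws.
pose h e := [set (ends e).1; (ends e).2].
rewrite /ein -(card_in_imset (f := h)); last first.
  move=> e f _ _ /setP ef; apply: (simp e f (ends f).1 (ends f).2); last exact: joins_ends.
  have := ll e; have := ef (ends e).1; have := ef (ends e).2.
  rewrite !inE !eqxx orbT /joins -!pair_eqE /pair_eq /=.
  by case/esym/orP=> /eqP-> /esym/orP[] /eqP->; rewrite ?eqxx ?orbT.
apply: subset_leq_card; apply/subsetP=> _ /imsetP[e + ->]; rewrite !inE => /and3P[_ aA bA].
by rewrite cards2 ll andbT subUset !sub1set aA bA.
Qed.

End Counting.

Section Connecting.
Variables (V E : finType) (ends : E -> V * V) (m r : nat).
Hypotheses (ll : loopless ends) (simp : simple ends).
Hypotheses (m0 : 0 < m) (mr : 2 * m <= r).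
Implicit Types (e f : E) (B C D F : {set E}) (A S U Y : {set V}) (x v : V).

Lemma max_sparse F : exists B, [/\ B \subset F, sparse ends m B
  & forall e, e \in F -> e \notin B -> teq ends m B (ends e).1 (ends e).2].
Proof.
have [n] := ubnP #|F|; elim: n F => // n IHn F ltn.
have [->|[e eF]] := set_0Vmem F.
  by exists set0; split=> [||e]; rewrite ?inE //; apply: sparse_set0.
have [|B [sB spB tB]] := IHn (F :\ e); first by rewrite (cardsD1 e F) eF in ltn.
have BF : B \subset F := subset_trans sB (subD1set _ _).
have [te|nte] := boolP (teq ends m B (ends e).1 (ends e).2).
  exists B; split=> // f fF fB; have [-> //|fe] := eqVneq f e.
  by apply: tB; rewrite ?inE ?fe.
have spB' := sparseU1 spB nte.
exists (e |: B); split=> //; first by rewrite subUset sub1set eF.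
move=> f fF; rewrite in_setU1 negb_or => /andP[fe fB].
apply: teq_sub (tB f _ fB) => //; first exact: subsetUr.
by rewrite !inE fF fe.
Qed.

Variables (F : {set E}) (U : {set V}).
Hypothesis U1 : #|U| <= 1.
Hypothesis degF : forall v, r <= deg ends F v.
Hypothesis tough : forall S,
  2 * m * r * omega ends S <= (r.+1 - 2 * m) * #|S| + 2 * m * r.

(** * The counting argument when the sparse set is too small *)

Section Blocked.
Variables (B0 M N : {set E}).
Hypotheses (B0F : B0 \subset F).
Hypothesis B0max : forall e, e \in F -> e \notin B0 -> teq ends m B0 (ends e).1 (ends e).2.
Hypotheses (gM : good ends m F B0 M (~: U)) (NM : N \subset M).
Hypothesis blocked : forall e, e \notin F -> inside ends (~: U) e ->
  (forall v, inc ends e v -> ~~ covered ends (M :\: N) v) ->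
  e \in N \/ teq ends m (B0 :|: N) (ends e).1 (ends e).2.
Hypothesis deficient : #|B0 :|: M| + m < m * #|V|.

Let D := M :\: N.
Let B := B0 :|: M.
Let B1 := B0 :|: N.
Let S := [set v | covered ends D v].
Let R := teq ends m B1.
Let P := classes R setT.
Let G := [set A in P | cut ends B1 A < 2 * m].

Let spB : sparse ends m B. Proof. exact: good_sparse gM. Qed.
Let sB1B : B1 \subset B. Proof. exact: setUS. Qed.
Let spB1 : sparse ends m B1. Proof. exact: sub_sparse spB. Qed.
Let eqR : equivalence_rel R. Proof. exact: teq_equiv. Qed.

Let tightP A : A \in P -> tight ends m B1 A.
Proof. by case/imsetP=> x _ ->; apply: class_tight. Qed.

Let inP x A : A \in P -> (x \in A) = (class R x == A).
Proof.
by move=> AP; apply/idP/eqP=> [|<-]; [apply: class_of_mem | apply: mem_class].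
Qed.

Let GP : G \subset P. Proof. by apply/subsetP=> A; rewrite inE => /andP[]. Qed.

Let disD : [disjoint B1 & D].
Proof.
rewrite -setI_eq0; apply/eqP/setP=> e; rewrite !inE.
case eM : (e \in M); last by rewrite !andbF.
by rewrite (negPf (good_notB0 B0F gM eM)) /=; case: (e \in N).
Qed.

Let eB : B = B1 :|: D.
Proof.
apply/setP=> e; rewrite !inE -orbA; congr (_ || _).
by case: (boolP (e \in N)) => // /(subsetP NM)->.
Qed.

Let cardB : #|B| = #|B1| + #|D|.
Proof. by rewrite eB cardsU; move: disD; rewrite -setI_eq0 => /eqP->; rewrite cards0 subn0. Qed.

Let degD v : deg ends D v = (v \in S).
Proof.
rewrite inE; case: (boolP (covered ends D v)) => [/coveredP[e eD ev]|nc].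
  apply/eqP/cards1P; exists e; apply/setP=> f; rewrite inE in_set1.
  apply/andP/eqP=> [[fD fv]|-> //].
  have [_ mM _] := gM; apply: mM fv ev; first by case/setDP: fD.
  by case/setDP: eD.
apply/eqP; rewrite cards_eq0; apply/eqP/setP=> e; rewrite !inE.
apply: contraNF nc => /andP[eD ev]; apply/coveredP; exists e => //.
by rewrite inE.
Qed.

Let cardS : #|S| = 2 * #|D|.
Proof.
rewrite -(sum_deg_total ll) -sum1_card big_mkcond /=.
by apply: eq_bigr => v _; rewrite degD; case: (v \in S).
Qed.

(** The parts are tight, so together they contain [m * (#|V| - #|P|)] edges of [B1]. The deficiency
    is doubled to match degree sums and [#|S| = 2 * #|D|]; its strictness becomes the final [2]. *)
Let many_parts : \sum_(A in P) cut ends B1 A + #|S| + 2 * m + 2 <= 2 * m * #|P|.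
Proof.
have h : \sum_(A in P) (2 * ein ends B1 A + cut ends B1 A) = 2 * #|B1|.
  rewrite -(sum_deg_total ll) -(sum_classes eqR); apply: eq_bigr => A _.
  by rewrite sum_deg.
have h2 : \sum_(A in P) 2 * ein ends B1 A + 2 * m * #|P| = 2 * m * #|V|.
  rewrite [2 * m * #|P|]mulnC -sum_nat_const -big_split /=.
  rewrite -[#|V|]sum1_card -(sum_classes eqR) big_distrr /=.
  apply: eq_bigr => A AP; rewrite sum1_card -mulnA -mulnDr.
  by rewrite (tightE (tightP AP)).
rewrite big_split /= in h; have := deficient; rewrite -/B cardB cardS.
move: h h2; move: (\sum_(A in P) cut _ _ _) (\sum_(A in P) 2 * _) => X Y.
by move: #|B1| #|D| #|P| #|V| => b d p v; nia.
Qed.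

(** Each part that is not good has at least [2 * m] leaving edges, which pay for its own term on the
    right. *)
Let good_parts : \sum_(A in G) cut ends B1 A + #|S| + 2 * m + 2 <= 2 * m * #|G|.
Proof.
have := many_parts; rewrite (bigID (fun A => A \in G)) /=.
have -> : \sum_(A in P | A \in G) cut ends B1 A = \sum_(A in G) cut ends B1 A.
  by apply: eq_bigl => A; rewrite !inE andbA andbb.
have bad : 2 * m * #|P :\: G| <= \sum_(A in P | A \notin G) cut ends B1 A.
  rewrite mulnC -sum_nat_const.
  rewrite (eq_bigl (fun A => (A \in P) && (A \notin G))) => [|A]; last by rewrite inE andbC.
  by apply: leq_sum => A /andP[AP]; rewrite inE AP /= -leqNgt.
have -> : #|P| = #|G| + #|P :\: G| by rewrite -(cardsID G P) (setIidPr GP).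
move: bad; rewrite mulnDr; move: #|P :\: G| #|G| => a b.
by move: (\sum_(A in P | _) _) (\sum_(A in G) _) => X Y; lia.
Qed.

Definition good_vertex x := class R x \in G.

Let GG := [set e in B1 | [&& ~~ R (ends e).1 (ends e).2, good_vertex (ends e).1 & good_vertex (ends e).2]].
Let GB := [set e in B1 | ~~ R (ends e).1 (ends e).2 && (good_vertex (ends e).1 != good_vertex (ends e).2)].

Let inGG e : (e \in GG) = [&& e \in B1, ~~ R (ends e).1 (ends e).2,
  good_vertex (ends e).1 & good_vertex (ends e).2].
Proof. by rewrite in_set. Qed.

Let inGB e : (e \in GB) = [&& e \in B1, ~~ R (ends e).1 (ends e).2
  & good_vertex (ends e).1 != good_vertex (ends e).2].
Proof. by rewrite in_set. Qed.

Let cut_sum : 2 * #|GG| + #|GB| <= \sum_(A in G) cut ends B1 A.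
Proof.
have -> : \sum_(A in G) cut ends B1 A = \sum_(e in B1) \sum_(A in G)
    (((ends e).1 \in A) != ((ends e).2 \in A)).
  rewrite exchange_big /=; apply: eq_bigr => A _.
  rewrite /cut -sum1_card -big_mkcondr /=.
  by apply: eq_bigl => e; rewrite !inE.
have -> : 2 * #|GG| + #|GB| = \sum_(e in B1) (2 * (e \in GG) + (e \in GB)).
  by rewrite big_split /= -big_distrr /= !sum_mem_sub //; apply/subsetP=> e; rewrite ?inGG ?inGB => /andP[].
apply: leq_sum => e eB1; rewrite inGG inGB eB1 /=.
case: (boolP (R _ _)) => [//|nR] /=.
have nc : class R (ends e).1 != class R (ends e).2.
  by apply: contra nR => /eqP/(class_eqP eqR).
apply: (@leq_trans (good_vertex (ends e).1 + good_vertex (ends e).2)).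
  by case: (good_vertex _); case: (good_vertex _).
have one x : \sum_(A in G) (x \in A) = good_vertex x.
  rewrite -(sum_eq_mem G (class R x)); apply: eq_bigr => A AG.
  by rewrite (inP x (subsetP GP A AG)).
rewrite -!one -big_split /=; apply: leq_sum => A AG.
rewrite !(inP _ (subsetP GP A AG)); move: nc.
by case: (eqVneq (class R (ends e).1) A) => [->|]; case: (eqVneq (class R (ends e).2) A).
Qed.

(** An edge of [F] outside [B0] has both ends in one part, so fewer than [2 * m <= r] edges of [F]
    leave [A]. But in a simple graph of minimum degree at least [r], a set of [a] vertices with
    [1 <= a <= r] is left by at least [a * (r + 1 - a) >= r] edges. *)
Let large_part A : A \in G -> r < #|A|.
Proof.
rewrite inE => /andP[AP cA].
have A0 : 0 < #|A| by rewrite card_gt0 (tight_neq0 (tightP AP)).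
have cF : cut ends F A <= cut ends B1 A.
  apply/subset_leq_card/subsetP=> e; rewrite !inE => /andP[eF ne]; rewrite ne andbT.
  case: (boolP (e \in B0)) => //= eB0.
  have := teq_sub spB1 (subsetUl B0 N) (B0max eF eB0); rewrite -/R => /(class_eqP eqR) ec.
  by move: ne; rewrite !(inP _ AP) ec eqxx.
have le : r * #|A| <= #|A| * #|A|.-1 + cut ends F A.
  apply: (@leq_trans (\sum_(v in A) deg ends F v)).
    by rewrite mulnC -sum_nat_const; apply: leq_sum.
  by rewrite sum_deg // leq_add2r ein_simple.
move: cF cA le A0 mr; move: (cut _ F A) (cut _ B1 A) #|A| => c c' a h1 h2 h3 h4 h5.
rewrite ltnNge; apply/negP=> ar.
have [b ab] : exists b, a = b.+1 by exists a.-1; lia.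
have [d rd] : exists d, r = a + d by exists (r - a); lia.
by subst a; rewrite rd /= in h3 h5; nia.
Qed.

(* Deleting [pick_end e] destroys [e]; an end in a part that is not good is
   preferred, so that only edges between two good parts can use up a good part. *)
Definition pick_end e :=
  if good_vertex (ends e).1 && ~~ good_vertex (ends e).2 then (ends e).2 else (ends e).1.

Let S' := S :|: U :|: [set pick_end e | e in GG :|: GB].

Let card_S' : #|S'| <= #|S| + 1 + #|GG| + #|GB|.
Proof.
apply: leq_trans (leq_card_setU _ _) _; rewrite -addnA leq_add //.
  by apply: leq_trans (leq_card_setU _ _) _; rewrite leq_add2l.
exact: leq_trans (leq_imset_card _ _) (leq_card_setU _ _).
Qed.

Let key x := if good_vertex x then Some (class R x) else None.

(** An edge between two parts that avoids [S] and [U] is in [B1]: by the choice of [B0] if it is in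
    [F], by [blocked] otherwise. If one of the two parts is good, an end of the edge was deleted;
    the parts that are not good share the key [None]. *)
Let separated x y : conn ends setT S' x y -> key x = key y.
Proof.
move=> c; apply/eqP; move: x y c; apply: conn_min.
  by move=> x y z; split=> [|/eqP->].
move=> e _ aS bS.
have incS v : inc ends e v -> v \notin S' by case/incP=> ->.
have [Re|nRe] := boolP (R (ends e).1 (ends e).2).
  by have /(class_eqP eqR) ec := Re; rewrite /key /good_vertex ec.
have eB1 : e \in B1.
  rewrite inE; have [eF|eF] := boolP (e \in F).
    apply/orP; left; apply: contraR nRe => eB0.
    exact: teq_sub spB1 (subsetUl B0 N) (B0max eF eB0).
  have [||->|te] := blocked eF; rewrite ?orbT //.
  - apply/insideP=> v /incS; rewrite !inE !negb_or => /andP[/andP[_ vU] _].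
    by rewrite vU.
  - by move=> v /incS; rewrite !inE !negb_or => /andP[/andP[]].
  - by rewrite /R te in nRe.
have ng : e \notin GG :|: GB.
  apply/negP=> eg; have : pick_end e \in S' by rewrite inE imset_f ?orbT.
  by rewrite /pick_end; case: ifP; rewrite ?(negPf aS) ?(negPf bS).
move: ng; rewrite /key in_setU inGG inGB eB1 nRe /=.
by case: (good_vertex _); case: (good_vertex _).
Qed.

Let Dead := [set A in G | A \subset S'].

Let survivors : #|G :\: Dead| <= omega ends S'.
Proof.
have surv A : A \in G :\: Dead -> exists2 x, x \in A & x \notin S'.
  rewrite !inE => /andP[h /andP[AP cA]]; move: h; rewrite AP cA /= => /subsetPn[x xA xS].
  by exists x.
have [/eqP|[A0 A0G]] := set_0Vmem (G :\: Dead); first by rewrite -cards_eq0 => /eqP->.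
have [x0 _ _] := surv A0 A0G.
pose rep (A : {set V}) := odflt x0 [pick x in A :\: S'].
have repP A : A \in G :\: Dead -> (rep A \in A) && (rep A \notin S').
  move=> /surv[x xA xS]; rewrite /rep; case: pickP => [y|/(_ x)] /=.
    by rewrite inE andbC.
  by rewrite inE xA xS.
rewrite -(card_in_imset (f := fun A => class (conn ends setT S') (rep A))); last first.
  move=> A1 A2 h1 h2 /(class_eqP (conn_equiv _ _ _))/separated.
  have /andP[r1 _] := repP _ h1; have /andP[r2 _] := repP _ h2.
  have P1 : A1 \in G by case/setDP: h1.
  have P2 : A2 \in G by case/setDP: h2.
  rewrite /key /good_vertex (class_of_mem eqR (subsetP GP _ P1) r1).
  by rewrite (class_of_mem eqR (subsetP GP _ P2) r2) P1 P2 => -[].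
apply: subset_leq_card; apply/subsetP=> _ /imsetP[A /repP/andP[_ rS] ->].
by apply: imset_f; rewrite in_setC.
Qed.

Let Y := [set x | class R x \in Dead].

Let DeadP : Dead \subset P.
Proof. by apply: subset_trans GP; apply/subsetP=> A; rewrite in_set => /andP[]. Qed.

Let sum_Dead (g : V -> nat) : \sum_(A in Dead) \sum_(x in A) g x = \sum_(x in Y) g x.
Proof. by rewrite (sum_subclasses eqR) //; apply: eq_bigl => x; rewrite [RHS]in_set. Qed.

Let sumS A : \sum_(x in A) (x \in S : nat) = #|A :&: S|.
Proof. by rewrite -sum1_card -big_mkcondr /=; apply: eq_bigl => x; rewrite in_setI. Qed.

(** A vertex of a dead part is in [S], in [U], or the first end of an edge of [GG], because the
    deleted end of an edge of [GB] is in a part that is not good. *)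
Let Dead_size : r.+1 * #|Dead| <= #|Y :&: S| + 1 + #|GG|.
Proof.
pose g x := (x \in S) + (x \in U) + #|[set e in GG | (ends e).1 == x]|.
apply: (@leq_trans (\sum_(A in Dead) \sum_(x in A) g x)).
  rewrite mulnC -sum_nat_const; apply: leq_sum => A AD.
  have /andP[AG AS] : (A \in G) && (A \subset S') by rewrite in_set in AD.
  apply: leq_trans (large_part AG) _; rewrite -sum1_card; apply: leq_sum => x xA.
  have := subsetP AS x xA; rewrite !in_setU /g => /orP[/orP[->|->]|] //.
    by rewrite addnC addnA addn1.
  case/imsetP=> e eg xe; rewrite addn_gt0; apply/orP; right.
  have gx : good_vertex x.
    by rewrite /good_vertex (class_of_mem eqR (subsetP GP A AG) xA).
  move: eg xe; rewrite in_setU inGG inGB -andb_orr /pick_end => /andP[eB1].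
  case: ifP => [/andP[_ ng] _ xe|]; first by rewrite -xe gx in ng.
  move=> h h2 xe; apply/card_gt0P; exists e; rewrite in_set inGG eB1 xe eqxx andbT /=.
  by move: h h2; rewrite -xe gx /=; case: (good_vertex _) => //=; rewrite ?andbF ?orbF ?andbT.
rewrite sum_Dead /g !big_split /= sumS.
apply: leq_add; first apply: leq_add => //.
  rewrite -big_mkcondr /= sum1_card; apply: leq_trans U1.
  by apply/subset_leq_card/subsetP=> x; rewrite unfold_in => /andP[].
rewrite (sum_fiber (fun e => (ends e).1) (fun e => e \in GG)); apply/subset_leq_card/subsetP=> e.
by rewrite inE => /andP[].
Qed.

(** [D] is a perfect matching of [S]: the vertices of [Y :&: S] not matched inside [Y] have distinct
    partners in [S] outside [Y]. *)
Let Dead_S : 2 * #|Y :&: S| <= #|S| + 2 * ein ends D Y.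
Proof.
have degS A : \sum_(v in A) deg ends D v = #|A :&: S|.
  by rewrite -sumS; apply: eq_bigr => v _; rewrite degD.
have := sum_deg ll D Y; have := sum_deg ll D (~: Y); rewrite !degS cut_setC.
have -> : #|S| = #|Y :&: S| + #|~: Y :&: S|.
  by rewrite -(cardsID Y S) setIC setDE [S :&: ~: _]setIC.
by lia.
Qed.

(** [B] is sparse on [Y], and the dead parts already contain [m * (#|Y| - #|Dead|)] edges of
    [B1]. *)
Let Dead_tight : #|Dead| = 0 \/ ein ends D Y + m <= m * #|Dead|.
Proof.
have [Y0|Y0] := eqVneq Y set0.
  left; apply/eqP; rewrite cards_eq0; apply/eqP/setP=> A; rewrite in_set0.
  apply/negP=> AD; have AP := subsetP DeadP A AD.
  have /set0Pn[x xA] := tight_neq0 (tightP AP).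
  by have := in_set0 x; rewrite -Y0 inE (class_of_mem eqR AP xA) AD.
right; have := spB Y0; rewrite eB einU //.
have cY : #|Y| = \sum_(A in Dead) #|A|.
  by rewrite -sum1_card -sum_Dead; apply: eq_bigr => A _; rewrite sum1_card.
have sub : \sum_(A in Dead) ein ends B1 A <= ein ends B1 Y.
  pose Z e := (e \in B1) && R (ends e).1 (ends e).2.
  have -> : \sum_(A in Dead) ein ends B1 A =
      \sum_(A in Dead) \sum_(x in A) #|[set e | Z e & (ends e).1 == x]|.
    apply: eq_bigr => A AD; rewrite sum_fiber; have AP := subsetP DeadP A AD.
    apply: eq_card => e; rewrite [LHS]in_set [RHS]in_set /Z -andbA; congr (_ && _).
    rewrite [RHS]andbC !(inP _ AP); case: eqP => //= <-.
    by rewrite eq_sym; apply/eqP/(class_eqP eqR).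
  rewrite sum_Dead sum_fiber; apply/subset_leq_card/subsetP=> e.
  rewrite in_set => /andP[/andP[eB1 /(class_eqP eqR) ec] e1Y]; rewrite in_set eB1 e1Y /=.
  by move: e1Y; rewrite /Y !in_set ec.
have : \sum_(A in Dead) ein ends B1 A + m * #|Dead| = m * #|Y|.
  rewrite cY big_distrr /= [m * _]mulnC -sum_nat_const -big_split /=.
  by apply: eq_bigr => A AD; rewrite (tightE (tightP (subsetP DeadP A AD))).
move: sub; move: (\sum_(A in Dead) _) (ein _ B1 Y) (ein _ D Y) (m * #|Y|) (m * #|Dead|).
by move=> a b c d e; lia.
Qed.

Lemma blocked_contradiction : False.
Proof.
apply: (@count_contradiction m r #|G :\: Dead| #|Dead| #|S| #|S'| #|GG| #|GB|
  #|Y :&: S| (ein ends D Y)) => //.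
- have -> : #|G :\: Dead| + #|Dead| = #|G|.
    rewrite addnC -(cardsID Dead G) (setIidPr _) //.
    by apply/subsetP=> A; rewrite in_set => /andP[].
  by apply: leq_trans good_parts; rewrite !leq_add2r cut_sum.
- by apply: leq_trans (tough S'); rewrite leq_mul2l survivors orbT.
Qed.

End Blocked.

Theorem connecting_matching : exists M, [/\ matching ends M, [disjoint F & M],
  forall e, e \in M -> inside ends (~: U) e & tree_connected ends m (F :|: M)].
Proof.
have [/card_gt0P[v0 _]|] := ltnP 0 #|V|; last first.
  rewrite leqn0 => /eqP/card0_eq V0; have noV (v : V) : False by have := V0 v; rewrite inE.
  exists set0; split=> [e f v _ _ _||e|]; rewrite ?inE //.
    by rewrite disjoint_sym disjoints_subset sub0set.
  exists (fun=> set0); split=> [i|]; first exact: sub0set.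
  split=> [i|i j _]; last by rewrite disjoints_subset sub0set.
  by split=> [x|e]; [case: (noV x)|rewrite inE].
have [B0 [B0F sp0 B0max]] := max_sparse F.
have [M [N [gM NM bl]]] := blocked_matching ll B0F (~: U) sp0.
have [iM mM spM] := gM.
exists M; split=> // [|e /iM[]//|].
  rewrite -setI_eq0; apply/eqP/setP=> e; rewrite !inE.
  by apply/negP=> /andP[eF /iM[/negP]].
have V0 : 0 < #|V| by apply/card_gt0P; exists v0.
apply: (@sparse_tree_connected _ _ ends m (B0 :|: M)) => //; first exact: setSU.
have : #|B0 :|: M| + m <= m * #|V|.
  have := spM setT; rewrite cardsT -cards_eq0 cardsT -lt0n => /(_ V0).
  apply: leq_trans; rewrite leq_add2r; apply/subset_leq_card/subsetP=> e.
  by rewrite !inE => ->.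
rewrite leq_eqVlt => /orP[/eqP//|def].
by case: (blocked_contradiction B0F B0max gM NM bl def).
Qed.

End Connecting.

(** * Degree-constrained subgraphs *)

Section Degrees.
Variables (V E : finType) (ends : E -> V * V).
Hypothesis ll : loopless ends.
Implicit Types (e : E) (F G H : {set E}) (u v w t x z : V).

Local Notation deg := (deg ends).

Lemma degU1 F e v : e \notin F -> deg (e |: F) v = deg F v + inc ends e v.
Proof.
move=> eF; rewrite /Defs.deg; case: (boolP (inc ends e v)) => ev.
  rewrite (_ : [set _ in _ | _] = e |: [set f in F | inc ends f v]) ?cardsU1 ?inE ?(negPf eF) 1?addnC //.
  apply/setP=> f; rewrite !inE -/(inc ends f v); case: eqVneq => // ->.
  by rewrite ev.
rewrite addn0; apply: eq_card => f; rewrite !inE -/(inc ends f v); case: eqVneq => // ->.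
by rewrite (negPf ev) !andbF.
Qed.

Lemma degC F v : deg (~: F) v + deg F v = deg setT v.
Proof.
rewrite /Defs.deg -cardsUI.
rewrite (_ : _ :&: _ = set0) ?cards0 ?addn0.
  by apply: eq_card => e; rewrite !inE; case: (e \in F); rewrite ?orbF.
by apply/setP=> e; rewrite !inE; case: (e \in F); rewrite ?andbF.
Qed.

Lemma deg_pos F e v : e \in F -> inc ends e v -> 0 < deg F v.
Proof. by move=> eF ev; apply/card_gt0P; exists e; rewrite !inE eF. Qed.

Lemma other_end e v : inc ends e v -> exists w, w != v /\ forall z, inc ends e z = (z == v) + (z == w) :> nat.
Proof.
have := ll e; rewrite /inc; case: (ends e) => a b /= ab /orP[]/eqP<-.
  exists b; rewrite eq_sym ab; split=> // z; rewrite [a == z]eq_sym [b == z]eq_sym.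
  by case: (eqVneq z a) => [->|_] //; rewrite (negPf ab).
exists a; rewrite ab; split=> // z; rewrite [a == z]eq_sym [b == z]eq_sym.
by case: (eqVneq z a) => [->|_]; rewrite ?(negPf ab) // addn0.
Qed.

Definition sdiff F G : {set E} := (F :\: G) :|: (G :\: F).

(* The degree sequences of the subgraphs of [ends] form a jump system. *)
Lemma deg_jump F G v : deg F v < deg G v ->
  exists F' w, #|sdiff F' G| < #|sdiff F G| /\
    ((forall z, deg F' z = deg F z + (z == v) + (z == w)) /\ deg F w + (w == v) < deg G w \/
     w != v /\ (forall z, deg F' z + (z == w) = deg F z + (z == v)) /\ deg G w < deg F w).
Proof.
have [n] := ubnP #|sdiff F G|; elim: n F G v => // n IHn F G v ltn Fv.
have downn F1 v1 : #|sdiff F1 G| < n -> deg G v1 < deg F1 v1 ->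
    exists F' w, #|sdiff F' G| < #|sdiff F1 G| /\
      ((forall z, deg F' z + (z == v1) + (z == w) = deg F1 z) /\ deg G w + (w == v1) < deg F1 w \/
       w != v1 /\ (forall z, deg F' z + (z == v1) = deg F1 z + (z == w)) /\ deg F1 w < deg G w).
  have sdC A B : sdiff (~: A) (~: B) = sdiff A B.
    by apply/setP=> e; rewrite !inE !negbK; case: (e \in A); case: (e \in B).
  move=> lt1 Gv1; have dC A z := degC A z.
  have [||F' [w [lt' h]]] := IHn (~: F1) (~: G) v1; first by rewrite sdC.
    by move: (dC F1 v1) (dC G v1) Gv1; clear; lia.
  exists (~: F'), w; split; first by move: lt'; rewrite -{1}[F']setCK !sdC.
  have fw := dC F1 w; have gw := dC G w.
  case: h => [[h1 h2]|[wv [h1 h2]]]; [left|right].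
    split=> [z|]; last by move: fw gw h2; clear; lia.
    by move: (h1 z) (dC F1 z) (dC F' z); clear; lia.
  split=> //; split=> [z|]; last by move: fw gw h2; clear; lia.
  by move: (h1 z) (dC F1 z) (dC F' z); clear; lia.
have [e /and3P[eG eF ev]|none] := pickP (fun e => [&& e \in G, e \notin F & inc ends e v]); last first.
  suff : deg G v <= deg F v by rewrite leqNgt Fv.
  apply/subset_leq_card/subsetP=> e; rewrite !inE => /andP[eG ev].
  by have := none e; rewrite eG [inc ends e v]ev andbT /= => /negbFE->.
have [w [wv incE]] := other_end ev.
set F1 := e |: F.
have dF1 z : deg F1 z = deg F z + (z == v) + (z == w) by rewrite degU1 // incE addnA.
have sd1 : #|sdiff F1 G| < #|sdiff F G|.
  rewrite [ltnRHS](cardsD1 e) !inE eF eG /= add1n ltnS.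
  apply/subset_leq_card/subsetP=> f; rewrite !inE.
  by case: (eqVneq f e) => [->|] //=; rewrite eG.
have [wlt|wge] := ltnP (deg F w) (deg G w).
  by exists F1, w; split=> //; left; rewrite (negPf wv) addn0.
(* Adding [e] has made the degree of its other end [w] too large; a step down from [w] repairs
   this. *)
have [||F' [u [lt' h]]] := downn F1 w; first exact: leq_trans sd1 _.
  by rewrite dF1 eqxx (negPf wv) addn0 addn1 ltnS.
exists F', u; split; first exact: ltn_trans lt' sd1.
case: h => [[h1 h2]|[uw [h1 h2]]].
  right; have uv : u != v.
    apply: contraTneq h2 => ->; rewrite dF1 eqxx eq_sym (negPf wv).
    by rewrite -leqNgt addn1 addn0 addn0.
  split=> //; split=> [z|]; first by move: (h1 z); rewrite dF1; clear; lia.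
  by move: h2; rewrite dF1 (negPf uv); clear; lia.
left; split=> [z|]; first by move: (h1 z); rewrite dF1; clear; lia.
by move: h2; rewrite dF1 (negPf uw) addn0.
Qed.

End Degrees.

(** * Gallai's argument for largest subgraphs under vertex capacities *)

Section BMatching.
Variables (V E : finType) (ends : E -> V * V).
Hypothesis ll : loopless ends.
Implicit Types (e : E) (F G H : {set E}) (u v w t x z : V) (f : V -> nat).

Local Notation deg := (deg ends).

Definition feasible f F : bool := [forall v, deg F v <= f v].

Definition optimal f F : Prop :=
  feasible f F /\ forall G, feasible f G -> #|G| <= #|F|.

(** For [u = v] this asks for a deficiency of at least two at that vertex. *)
Definition deficient2 f F u v : bool :=
  (deg F u + (u == v) < f u) && (deg F v + (u == v) < f v).

Lemma feasibleP f F : reflect (forall v, deg F v <= f v) (feasible f F).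
Proof. exact: forallP. Qed.

Lemma ex_optimal f : exists F, optimal f F.
Proof.
have f0 : feasible f set0.
  apply/feasibleP=> v; rewrite /Defs.deg (_ : [set _ in _ | _] = set0) ?cards0 //.
  by apply/setP=> e; rewrite !inE.
by case: (arg_maxnP (fun F : {set E} => #|F|) f0) => F fF maxF; exists F; split.
Qed.

Lemma optimal_card f F G : optimal f F -> optimal f G -> #|F| = #|G|.
Proof. by move=> [fF mF] [fG mG]; apply/eqP; rewrite eqn_leq mF ?mG. Qed.

(* As in Gallai's lemma on matchings, [G] is moved towards [F] until the two
   deficiencies of [F] and the one of [G] meet. *)
Lemma gallai f u v t F G : optimal f F -> deficient2 f F u v ->
  optimal f G -> deg G t < f t ->
  exists H, optimal f H /\ (deficient2 f H u t || deficient2 f H t v).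
Proof.
move=> oF /andP[du dv]; have [n] := ubnP #|sdiff G F|.
elim: n G => // n IHn G ltn oG dt.
have done1 H : optimal f H -> deficient2 f H u t || deficient2 f H t v ->
    exists H, optimal f H /\ (deficient2 f H u t || deficient2 f H t v) by exists H.
have [tu|tu] := eqVneq t u; first by apply: (done1 F oF); rewrite tu /deficient2 du dv orbT.
have [tv|tv] := eqVneq t v; first by apply: (done1 F oF); rewrite tv /deficient2 du dv.
have ut : (u == t) = false by rewrite eq_sym (negPf tu).
have [fF maxF] := oF; have [fG maxG] := oG.
have leF z : deg F z <= f z by apply/feasibleP.
have leG z : deg G z <= f z by apply/feasibleP.
have [Ft|Ft] := ltnP (deg F t) (f t).
  by apply: (done1 F oF); rewrite /deficient2 ut !addn0 Ft; apply/orP; left; rewrite andbT (leq_ltn_trans (leq_addr _ _) du).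
have [Gu|Gu] := ltnP (deg G u) (f u).
  by apply: (done1 G oG); rewrite /deficient2 ut !addn0 Gu dt.
have [Gv|Gv] := ltnP (deg G v) (f v).
  by apply: (done1 G oG); rewrite /deficient2 (negPf tv) !addn0 Gv dt orbT.
have cFG : #|F| = #|G| := optimal_card oF oG.
have [w /andP[Gw wt]|none] := pickP (fun w => (deg G w < deg F w) && (deg G w + (w == t) < f w)); last first.
  have : \sum_z (deg F z + (z == u) + (z == v)) <= \sum_z (deg G z + (z == t)).
    apply: leq_sum => z _; have := none z; have Fz := leF z.
    case: (eqVneq z t) Fz => [->|zt] Fz.
      rewrite (negPf tu) (negPf tv) !addn0 !addn1 => nt.
      rewrite leqNgt; apply/negP=> lt; move: nt; rewrite (ltnW lt).
      by rewrite (leq_trans lt Fz).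
    rewrite !addn0 => nz; have FG : deg F z <= deg G z.
      rewrite leqNgt; apply/negP=> lt; move: nz; rewrite lt.
      by rewrite (leq_trans lt Fz).
    case: (eqVneq z u) FG => [->|zu] FG; first by rewrite addn1 addSn (leq_trans du Gu).
    case: (eqVneq z v) FG => [->|zv] FG; rewrite !addn0 // addn1.
    by apply: leq_trans Gv; apply: leq_ltn_trans (leq_addr _ _) dv.
  rewrite !big_split /= !(sum_deg_total ll) cFG.
  have one x : \sum_z (z == x) = 1.
    by rewrite (bigD1 x) //= eqxx big1 // => z /negPf->.
  by rewrite !one; clear; lia.
have [H [z [lt' h]]] := deg_jump ll Gw.
have dsum : 2 * #|H| = \sum_z deg H z by rewrite sum_deg_total.
have gsum : 2 * #|G| = \sum_z deg G z by rewrite sum_deg_total.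
have one x : \sum_z (z == x) = 1.
  by rewrite (bigD1 x) //= eqxx big1 // => y /negPf->.
(* Two steps up would yield a feasible set with more edges than [G]. So the step up at [w] comes
   with a step down at [z], and the size stays the same. *)
case: h => [[h1 h2]|[zw [h1 h2]]].
  have fH : feasible f H.
    apply/feasibleP=> x; rewrite h1; case: (eqVneq x z) => [->|xz].
      by rewrite addn1; apply: leq_trans h2 (leF z).
    rewrite addn0; case: (eqVneq x w) => [->|xw]; last by rewrite addn0.
    by rewrite addn1; apply: leq_trans Gw (leF w).
  have := maxG H fH; suff -> : #|H| = #|G|.+1 by rewrite ltnn.
  have : 2 * #|H| = 2 * #|G| + 1 + 1.
    rewrite dsum (eq_bigr (fun x => deg G x + (x == w) + (x == z))) => [|x _ //].
    by rewrite !big_split /= !one gsum.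
  by clear; lia.
have fH : feasible f H.
  apply/feasibleP=> x; apply: leq_trans (leq_addr (x == z) _) _; rewrite h1.
  case: (eqVneq x w) => [->|xw]; last by rewrite addn0.
  by rewrite addn1; apply: leq_trans Gw (leF w).
have cH : #|H| = #|G|.
  have : 2 * #|H| + 1 = 2 * #|G| + 1.
    have : \sum_x (deg H x + (x == z)) = \sum_x (deg G x + (x == w)).
      by apply: eq_bigr => x _; rewrite h1.
    by rewrite !big_split /= !one dsum gsum.
  by clear; lia.
apply: (IHn H); first exact: leq_trans lt' _.
  by split=> // A /maxG; rewrite cH.
have zt : z != t by apply: contraTneq h2 => ->; rewrite -leqNgt (leq_trans (leG t)).
have := h1 t; rewrite eq_sym (negPf zt) addn0 => ->.
by case: (eqVneq t w) wt => [-> //|_] _; rewrite addn0.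
Qed.

Lemma deficient2C f F u v : deficient2 f F u v = deficient2 f F v u.
Proof. by rewrite /deficient2 andbC eq_sym. Qed.

Definition critical f : Prop :=
  forall v, 0 < f v -> exists2 F, optimal f F & deg F v < f v.

Section Critical.
Variable f : V -> nat.
Hypothesis crit : critical f.
Hypothesis cap : forall e, (f (ends e).1 <= 1) || (f (ends e).2 <= 1).

Let Z := [set v | f v == 0].

Definition tied u v : Prop := forall F, optimal f F -> ~~ deficient2 f F u v.

Lemma tied_sym u v : tied u v -> tied v u.
Proof. by move=> h F /h; rewrite deficient2C. Qed.

(** Criticality supplies an optimal set deficient at [t], to which [gallai] applies. *)
Lemma tied_trans t u v : 0 < f t -> tied u t -> tied t v -> tied u v.
Proof.
move=> t0 ut tv F oF; apply/negP=> d2; have [G oG Gt] := crit t0.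
have [H [oH /orP[]]] := gallai oF d2 oG Gt; first exact/negP/ut.
exact/negP/tv.
Qed.

(** If both ends were deficient, an edge outside the optimal set could be added, while an edge in it
    saturates whichever end has capacity at most one. *)
Lemma tied_adj e u v : joins ends e u v -> tied u v.
Proof.
move=> euv F [fF maxF]; apply/negP.
have [iu iv] : inc ends e u /\ inc ends e v.
  by case: (joinsP euv) => -[-> ->]; rewrite ?inc1 ?inc2.
have uv : u != v.
  by case: (joinsP euv) (ll e) => -[-> ->] //; rewrite eq_sym.
rewrite /deficient2 (negPf uv) !addn0 => /andP[du dv].
have [eF|eF] := boolP (e \in F).
  have := deg_pos eF iu; have := deg_pos eF iv.
  by case: (joinsP euv) (cap e) => -[<- <-]; lia.
have fF' : feasible f (e |: F).
  apply/feasibleP=> z; rewrite degU1 //; case: (boolP (inc ends e z)) => [ez|_].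
    rewrite addn1; case: (joinsP euv) (incP ez) => -[<- <-] [] ->//.
  by rewrite addn0; apply/feasibleP.
by have := maxF _ fF'; rewrite cardsU1 eF ltnn.
Qed.

Lemma tied_conn u v : u \notin Z -> conn ends setT Z u v -> u = v \/ tied u v.
Proof.
move=> uZ /connectP[p]; elim/last_ind: p v => [|p w IHp] v /=; first by move=> _ ->; left.
rewrite rcons_path last_rcons => /andP[pp /and3P[tZ wZ /exists_inP[e _ etw]]] ->.
right; have tw := tied_adj etw.
case: (IHp _ pp erefl) => [-> //|]; move/tied_trans; apply=> //.
by rewrite lt0n; move: tZ; rewrite inE.
Qed.

End Critical.

(* As long as some vertex is saturated by every optimal subgraph, its capacity is
   lowered by one: this costs exactly one edge. *)
Lemma critical_reduction f F : optimal f F -> exists f' F',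
  [/\ forall v, f' v <= f v, optimal f' F',
      #|F'| + \sum_v f v = #|F| + \sum_v f' v & critical f'].
Proof.
have [n] := ubnP (\sum_v f v); elim: n f F => // n IHn f F ltn oF.
have [cr|ncr] := classic (critical f); first by exists f, F; split.
have [v nv] := not_all_ex_not _ _ ncr; have [v0 ndef] := imply_to_and _ _ nv.
have sat G : optimal f G -> deg G v = f v.
  move=> oG; have [fG _] := oG; apply/eqP; rewrite eqn_leq (feasibleP _ _ fG) leqNgt.
  by apply/negP=> lt; apply: ndef; exists G.
pose f1 z := f z - (z == v).
have sumf : \sum_z f z = (\sum_z f1 z).+1.
  rewrite (bigD1 v) //= [X in _ = X.+1](bigD1 v) //= /f1 eqxx -addSn; congr (_ + _); first by lia.
  by apply: eq_bigr => z /negPf->; rewrite subn0.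
have f1f z : f1 z <= f z by apply: leq_subr.
have [F1 oF1] := ex_optimal f1.
have [fF maxF] := oF; have [fF1 maxF1] := oF1.
have fF1' : feasible f F1.
  by apply/feasibleP=> z; apply: leq_trans (f1f z); apply/feasibleP.
have c1 : #|F1|.+1 = #|F|.
  apply/eqP; rewrite eqn_leq; apply/andP; split.
    rewrite ltn_neqAle maxF // andbT; apply/negP=> /eqP c.
    have oF1' : optimal f F1 by split=> // G /maxF; rewrite c.
    by have := feasibleP _ _ fF1 v; rewrite sat // /f1 eqxx; lia.
  have /card_gt0P[e] : 0 < deg F v by rewrite sat.
  rewrite inE => /andP[eF ev]; rewrite (cardsD1 e) eF add1n ltnS; apply: maxF1.
  apply/feasibleP=> z; rewrite /f1; have := feasibleP _ _ fF z.
  rewrite -{1}(setD1K eF) degU1 ?inE ?eqxx //.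
  case: eqVneq => [->|_]; first by rewrite /inc ev; lia.
  by lia.
have [|f' [F' [le' oF' cF' cr']]] := IHn f1 F1 _ oF1; first by rewrite sumf in ltn.
exists f', F'; split=> // [z|]; first exact: leq_trans (le' z) (f1f z).
by rewrite sumf addnS cF' -c1 addSn.
Qed.

End BMatching.

(** * Factors with prescribed degrees *)

Section Subdivision.
Variables (V E : finType) (ends : E -> V * V).
Hypothesis ll : loopless ends.
Variable f : V -> nat.

Definition endpoint (p : E * bool) : V := if p.2 then (ends p.1).2 else (ends p.1).1.

Definition opposite (p : E * bool) : E * bool := (p.1, ~~ p.2).

Local Notation V' := (V + E * bool)%type.
Local Notation E' := (E * option bool)%type.

(* Each edge of the graph is subdivided twice, so that all the vertices of the
   new graph other than those of [V] have capacity one. *)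
Definition sends (p : E') : V' * V' :=
  if p.2 is Some b then (inl (endpoint (p.1, b)), inr (p.1, b))
  else (inr (p.1, false), inr (p.1, true)).

Definition scap (z : V') : nat := if z is inl v then f v else 1.

Local Notation inc' := (inc sends).
Local Notation deg' := (deg sends).

Lemma sloopless : loopless sends.
Proof. by case=> e [b|]; apply/eqP. Qed.

Lemma scapP (g : V' -> nat) : (forall z, g z <= scap z) ->
  forall p, (g (sends p).1 <= 1) || (g (sends p).2 <= 1).
Proof.
by move=> le [e [b|]] /=; [rewrite (le (inr (e, b))) orbT | rewrite (le (inr (e, false)))].
Qed.

Lemma oppositeK : involutive opposite.
Proof. by case=> e b; rewrite /opposite negbK. Qed.

Lemma inc_half p e : inc' p (inr e) -> p = (e.1, Some e.2) \/ p = (e.1, None).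
Proof.
case: p => e' [b|]; rewrite /inc /sends /=; first by move=> /eqP[<-]; left.
by case/orP=> /eqP[<-]; right.
Qed.

Lemma inc_vertex p v : inc' p (inl v) -> exists b, p = (p.1, Some b) /\ endpoint (p.1, b) = v.
Proof.
case: p => e [b|]; rewrite /inc /sends //= orbF => /eqP[<-].
by exists b.
Qed.

Lemma half_inc e b : inc' (e, Some b) (inr (e, b)).
Proof. by rewrite /inc /sends eqxx orbT. Qed.

Lemma none_inc p : inc' (p.1, None) (inr p).
Proof. by case: p => e []; rewrite /inc /sends /= eqxx ?orbT. Qed.

Lemma vertex_inc e b : inc' (e, Some b) (inl (endpoint (e, b))).
Proof. by rewrite /inc /sends eqxx. Qed.

Lemma deg_two (F : {set E'}) p q z : p \in F -> q \in F -> p != q ->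
  inc' p z -> inc' q z -> 1 < deg' F z.
Proof.
move=> pF qF pq pz qz; apply: (@leq_trans #|[set p; q]|); first by rewrite cards2 pq.
apply/subset_leq_card/subsetP=> t; rewrite !inE => /orP[]/eqP->.
  by rewrite pF -/(inc' p z).
by rewrite qF -/(inc' q z).
Qed.

(** Each half vertex is on exactly one chosen edge, the middle one or its outer one. So the two
    outer edges of [e] are both chosen or both not, and [e] is taken in the former case. *)
Lemma factor_of_sfactor (F : {set E'}) : (forall z, deg' F z = scap z) ->
  exists G : {set E}, forall v, deg ends G v = f v.
Proof.
move=> sat; pose G := [set e | (e, Some false) \in F].
have someF e b : ((e, Some b) \in F) = ((e, None) \notin F).
  case: (boolP (_ \in F)) => h; case: (boolP ((e, None) \in F)) => h' //.
    have ne : (e, Some b) != (e, None) by apply/eqP.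
    by have := deg_two h h' ne (half_inc e b) (none_inc (e, b)); rewrite sat.
  have /card_gt0P[p] : 0 < deg' F (inr (e, b)) by rewrite sat.
  rewrite !inE => /andP[pF /inc_half[] ep]; first by rewrite -ep pF in h.
  by rewrite -ep pF in h'.
exists G => v; rewrite -[f v]/(scap (inl v)) -sat.
pose h e : E' := (e, Some ((ends e).2 == v)).
have h_inj : injective h by move=> e e' [].
rewrite /Defs.deg -(card_imset _ h_inj); apply: eq_card => p.
apply/imsetP/idP => [[e]|].
  rewrite !inE => /andP[eG ev ->]; rewrite someF -(someF e false) eG /=.
  move: ev; rewrite /h /endpoint /=; case: (eqVneq (ends e).2 v) => [->|_]; rewrite ?eqxx ?orbF //.
rewrite !inE => /andP[pF /inc_vertex[b [ep hv]]].
exists p.1; last first.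
  rewrite {1}ep /h; congr (_, Some _); move: hv; rewrite /endpoint /=; case: b {ep} => hv.
    by rewrite hv eqxx.
  by apply/esym/negP=> /eqP e2; have := ll p.1; rewrite hv e2 eqxx.
rewrite !inE someF -(someF _ b) -ep pF /=; move: hv; rewrite /endpoint /=.
by case: b {ep} => ->; rewrite eqxx ?orbT.
Qed.

(* The degree of [v] in the graph without [S]. *)
Definition deg_avoiding (S : {set V}) (v : V) : nat :=
  #|[set p | endpoint (opposite p) \notin S & endpoint p == v]|.

(** * Reading off a barrier from a critical capacity *)

Section Barrier.
Variables (g : V' -> nat) (F : {set E'}).
Hypothesis le_g : forall z, g z <= scap z.
Hypothesis oF : optimal sends g F.
Hypothesis crit : critical sends g.
Hypothesis big_deficiency : \sum_z scap z + 2 + 2 * #|F| <= 2 * \sum_z g z.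

Let Z := [set z | g z == 0].
Let S := [set v | g (inl v) == 0].
(** Once the vertices of capacity zero are deleted from the subdivided graph, the vertices of [T]
    and the halves in [Iso] are isolated. Any other deficient vertex has a vertex of [W] in its
    component, namely the one given by [rho]. *)
Let T := [set v | (v \notin S) && [forall p, (endpoint p == v) ==> (g (inr p) == 0)]].
Let W := ~: (S :|: T).
Let Iso := [set p | [&& endpoint p \in S, g (inr p) != 0 & g (inr (opposite p)) == 0]].
Let E1 := [set e | (g (inr (e, false)) != 0) && (g (inr (e, true)) != 0)].
Let C := [set e | [&& e \notin E1, (ends e).1 \in W & (ends e).2 \in W]].
Let Dead := [set p | g (inr p) == 0].
Let Def := [set z | (deg' F z < g z) && (if z is inr p then p \notin Iso else if z is inl v then v \in W else false)].
Let rho (z : V') : V := match z with inl v => v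
  | inr p => if endpoint p \in W then endpoint p else endpoint (opposite p) end.

Let inS v : (v \in S) = (g (inl v) == 0). Proof. by rewrite in_set. Qed.
Let inZ z : (z \in Z) = (g z == 0). Proof. by rewrite in_set. Qed.
Let inW v : (v \in W) = (v \notin S) && (v \notin T).
Proof. by rewrite in_setC in_setU negb_or. Qed.

Let live_half p : g (inr p) != 0 -> endpoint p \notin T.
Proof.
move=> gp; apply/negP; rewrite in_set => /andP[_ /forallP/(_ p)].
by rewrite eqxx (negPf gp).
Qed.

Let feas z : deg' F z <= g z.
Proof. by case: oF => /feasibleP. Qed.

Let ties u v : u \notin Z -> conn sends setT Z u v -> u != v ->
  deg' F u < g u -> deg' F v < g v -> False.
Proof.
move=> uZ c uv du dv; have [e|/(_ F oF)] := tied_conn sloopless crit (scapP le_g) uZ c.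
  by rewrite e eqxx in uv.
by rewrite /deficient2 (negPf uv) !addn0 du dv.
Qed.

Let step p u v : joins sends p u v -> u \notin Z -> v \notin Z -> conn sends setT Z u v.
Proof.
move=> j uZ vZ; apply: connect1; rewrite /adjD uZ vZ; apply/exists_inP.
by exists p.
Qed.

Let step_half p : g (inr p) != 0 -> endpoint p \notin S ->
  conn sends setT Z (inr p) (inl (endpoint p)).
Proof.
move=> gp hS; apply: (@step (p.1, Some p.2)); rewrite ?inZ // -?inS //.
by apply/orP; right; apply/eqP; case: (p).
Qed.

Let step_opp p : g (inr p) != 0 -> g (inr (opposite p)) != 0 ->
  conn sends setT Z (inr p) (inr (opposite p)).
Proof.
move=> gp go; apply: (@step (p.1, None)); rewrite ?inZ //.
by apply/orP; case: (p) => e []; [right|left]; apply/eqP.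
Qed.

Let def_half p : deg' F (inr p) < g (inr p) -> deg' F (inr p) = 0 /\ g (inr p) = 1.
Proof. by have := le_g (inr p) => /=; lia. Qed.

Let Def_rho z : z \in Def -> [/\ z \notin Z, rho z \in W & conn sends setT Z z (inl (rho z))].
Proof.
rewrite in_set inZ => /andP[dz]; have gz : g z != 0 by rewrite -lt0n (leq_trans _ dz).
case: z dz gz => [v|p] dz gz /= h; first by split=> //; apply: connxx.
case: (boolP (endpoint p \in W)) => hW.
  by split=> //; apply: step_half => //; move: hW; rewrite inW => /andP[].
move: hW; rewrite inW (live_half gz) andbT negbK => hS.
move: h; rewrite in_set hS gz /= => go.
(* With both ends in [S], the two halves are tied, so the opposite half is saturated. The only edge
   that can saturate it is the middle one, which saturates [p] too. *)
have oS : endpoint (opposite p) \notin S.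
  apply/negP=> oS; have [d0 _] := def_half dz.
  have do0 : 0 < deg' F (inr (opposite p)).
    rewrite lt0n; apply/eqP=> do0.
    apply: (@ties (inr p) (inr (opposite p))) => //.
    - by rewrite inZ.
    - exact: step_opp.
    - by apply/eqP=> -[]; case: (p) => e [].
    - by rewrite do0 lt0n.
  have /card_gt0P[q] := do0; rewrite in_set => /andP[qF /inc_half[] eq].
    have := feas (inl (endpoint (opposite p))); rewrite inS in oS; rewrite (eqP oS) leqn0.
    apply/negP; rewrite -lt0n; apply: (deg_pos qF); rewrite eq.
    exact: (@vertex_inc p.1 (~~ p.2)).
  suff : 0 < deg' F (inr p) by rewrite d0.
  by apply: (deg_pos qF); rewrite eq; apply: (none_inc p).
split=> //; first by rewrite inW (live_half go) oS.
by apply: conn_trans (step_opp gz go) _; apply: step_half.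
Qed.

Let lift_conn x y : conn ends E1 (S :|: T) x y -> conn sends setT Z (inl x) (inl y).
Proof.
apply: (@conn_min _ _ _ _ _ (fun x y => conn sends setT Z (inl x) (inl y))).
  by move=> a b c; apply: conn_equiv.
move=> e; rewrite in_set !in_setU !negb_or => /andP[g0 g1] /andP[aS _] /andP[bS _].
have h0 := @step_half (e, false) g0 aS; have h1 := @step_half (e, true) g1 bS.
rewrite conn_sym in h0; apply: conn_trans (conn_trans h0 _) h1.
exact: (@step_opp (e, false)).
Qed.

(** All vertices of a component are tied to each other, so no component contains two elements of
    [Def]. *)
Let card_Def : #|Def| <= comps ends E1 (S :|: T).
Proof.
rewrite -(card_in_imset (f := fun z => class (conn ends E1 (S :|: T)) (rho z))).
  apply/subset_leq_card/subsetP=> _ /imsetP[z /Def_rho[_ zW _] ->].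
  exact: imset_f.
move=> z z' zD zD' /(class_eqP (conn_equiv _ _ _))/lift_conn c.
have [zZ _ cz] := Def_rho zD; have [_ _ cz'] := Def_rho zD'.
have [//|zz'] := eqVneq z z'; exfalso; apply: (ties zZ _ zz').
- by rewrite conn_sym in cz'; apply: conn_trans (conn_trans cz c) cz'.
- by move: zD; rewrite in_set => /andP[].
- by move: zD'; rewrite in_set => /andP[].
Qed.

Let comps_E1 : comps ends E1 (S :|: T) <= omega ends (S :|: T) + #|C|.
Proof.
apply: leq_trans (comps_add _ _ C _) _; rewrite leq_add2r omegaE /comps.
rewrite (eq_classes (R' := conn ends setT (S :|: T))) // => x y.
apply/idP/idP; first exact/conn_sub/subsetT.
apply: conn_min (conn_equiv _ _ _) _ _ _ => e _ aW bW; apply: conn_edge => //.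
by rewrite in_setU [e \in C]in_set !in_setC aW bW !andbT orNb.
Qed.

(** Three disjoint sets of dead halves are counted: the opposites of [Iso], the halves at [T] whose
    edge does not lead to [S], and one dead half for each edge of [C]. *)
Let card_Dead : #|Iso| + \sum_(v in T) deg_avoiding S v + #|C| <= #|Dead|.
Proof.
rewrite sum_fiber.
have -> : #|Iso| = #|[set opposite p | p in Iso]|.
  by rewrite card_imset //; apply: (can_inj oppositeK).
pose h e := (e, g (inr (e, true)) == 0).
have -> : #|C| = #|[set h e | e in C]| by rewrite card_imset // => e e' [].
set A1 := [set _ | _ in Iso]; set A2 := [set _ | _ & _]; set A3 := [set _ | _ in C].
have h1 p : p \in A1 -> p \in Dead /\ endpoint (opposite p) \in S.
  by case/imsetP=> q; rewrite in_set => /and3P[hS _ go] ->; rewrite in_set oppositeK.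
have h2 p : p \in A2 -> [/\ p \in Dead, endpoint (opposite p) \notin S & endpoint p \in T].
  rewrite in_set => /andP[oS hT]; split=> //; rewrite in_set.
  by apply: contraLR hT; apply: live_half.
have h3 p : p \in A3 -> [/\ p \in Dead, endpoint (opposite p) \notin S & endpoint p \notin T].
  case/imsetP=> e; rewrite in_set => /and3P[eE1 aW bW] ->.
  have ab b : endpoint (e, b) \in W by case: b.
  split; last by have := ab (h e).2; rewrite inW => /andP[].
    rewrite in_set /h; move: eE1; rewrite in_set negb_and !negbK.
    by case: (boolP (g (inr (e, true)) == 0)) => // _; rewrite orbF.
  by have := ab (~~ (h e).2); rewrite inW => /andP[].
rewrite -cardsUI (_ : A1 :&: A2 = set0) ?cards0 ?addn0; last first.
  by apply/setP=> p; rewrite in_setI in_set0; apply/negP=> /andP[/h1[_ oS] /h2[_]]; rewrite oS.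
rewrite -cardsUI (_ : _ :&: A3 = set0) ?cards0 ?addn0; last first.
  apply/setP=> p; rewrite in_setI in_setU in_set0; apply/negP=> /andP[+ /h3[_ oS hT]].
  by case/orP=> [/h1[_]|/h2[_ _]]; rewrite ?(negPf oS) ?(negPf hT).
apply/subset_leq_card/subsetP=> p; rewrite !in_setU.
by case/orP=> [/orP[/h1[]|/h2[]]|/h3[]].
Qed.

Let deficiency_le z : g z - deg' F z <=
  (if z is inl v then (if v \in T then f v else 0) else 0)
  + (if z is inr p then p \in Iso else false) + (z \in Def).
Proof.
have [->|d0] := eqVneq (g z - deg' F z) 0; first exact: leq0n.
have dz : deg' F z < g z by rewrite -subn_gt0 lt0n.
rewrite in_set dz; case: z d0 dz => [v|p] d0 dz /=; last first.
  apply: (@leq_trans 1); last by case: (p \in Iso).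
  exact: leq_trans (leq_subr _ _) (le_g (inr p)).
case: (boolP (v \in T)) => vT.
  by rewrite -addnA; apply: leq_trans (leq_addr _ _); apply: leq_trans (leq_subr _ _) (le_g (inl v)).
have vS : v \notin S by rewrite inS -lt0n (leq_ltn_trans _ dz).
rewrite inW vS vT /=.
have : ~~ [forall p, (endpoint p == v) ==> (g (inr p) == 0)] by move: vT; rewrite in_set vS.
rewrite negb_forall => /existsP[p]; rewrite negb_imply => /andP[/eqP hv gp].
have j : joins sends (p.1, Some p.2) (inl v) (inr p).
  by rewrite -hv; apply/orP; left; apply/eqP; case: (p).
(* A vertex of [W] is tied to a live half and that half to it; by transitivity it is tied to itself,
   so its deficiency is at most one. *)
have t1 := tied_adj sloopless (scapP le_g) j.
have t2 : tied sends g (inr p) (inl v) by apply: tied_sym.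
have p0 : 0 < g (inr p) by rewrite lt0n.
have /(_ F oF) := tied_trans sloopless crit p0 t1 t2.
by rewrite /deficient2 eqxx andbb -leqNgt leq_subLR.
Qed.

Lemma barrier_exists : exists S T : {set V}, [disjoint S & T] /\
  \sum_(v in S) f v + \sum_(v in T) deg_avoiding S v + 2 <= \sum_(v in T) f v + omega ends (S :|: T).
Proof.
exists S, T; split.
  rewrite -setI_eq0; apply/eqP/setP=> v; rewrite in_setI in_set0.
  by apply/negP=> /andP[vS]; rewrite in_set vS.
have sum_g : \sum_z g z + \sum_(v in S) f v + #|Dead| <= \sum_z scap z.
  have hV : \sum_v g (inl v) + \sum_(v in S) f v <= \sum_v f v.
    rewrite [X in _ + X]big_mkcond -big_split /=; apply: leq_sum => v _.
    by case: ifP => [|_]; rewrite ?addn0 ?(le_g (inl v)) // inS => /eqP->.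
  have hE : \sum_p g (inr p) + #|Dead| <= \sum_(p : E * bool) 1.
    rewrite -sum1_card [X in _ + X]big_mkcond -big_split /=; apply: leq_sum => p _.
    by case: ifP => [|_]; rewrite ?addn0 ?(le_g (inr p)) // in_set => /eqP->.
  rewrite !big_sumType /=; move: hV hE.
  move: (\sum_v g (inl v)) (\sum_(v in S) f v) (\sum_v f v) (\sum_p g (inr p)) #|Dead|.
  by move: (\sum_(p : E * bool) 1) => *; lia.
have sum_def : \sum_z g z <= 2 * #|F| + \sum_(v in T) f v + #|Iso| + #|Def|.
  rewrite -(sum_deg_total sloopless).
  apply: (@leq_trans (\sum_z (deg' F z + ((if z is inl v then (if v \in T then f v else 0) else 0)
     + (if z is inr p then p \in Iso else false) + (z \in Def))))).
    by apply: leq_sum => z _; rewrite -leq_subLR; apply: deficiency_le.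
  rewrite !big_split /= -!addnA leq_add2l.
  rewrite [X in X + _ <= _]big_sumType [X in _ + (X + _) <= _]big_sumType /=.
  rewrite big1_eq addn0 big1_eq add0n -big_mkcond /= leq_add2l.
  by rewrite leq_add // -sum1_card [leqRHS]big_mkcond; apply: leq_sum => i _; case: (_ \in _).
have := comps_E1; have := card_Def; have := card_Dead; have := big_deficiency.
move: sum_g sum_def; move: (\sum_z g z) (\sum_z scap z) (\sum_(v in S) f v).
move: (\sum_(v in T) f v) (\sum_(v in T) deg_avoiding S v).
move: (comps _ _ _) (omega _ _) #|C| #|Def| #|Dead| #|Iso| #|F|; clear; lia.
Qed.

End Barrier.

(* A sufficient condition in the style of Tutte's f-factor theorem, with all
   components counted instead of the odd ones only. *)
Theorem factor_or_barrier : ~~ odd (\sum_v f v) ->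
  (exists G : {set E}, forall v, deg ends G v = f v) \/
  exists S T : {set V}, [disjoint S & T] /\
  \sum_(v in S) f v + \sum_(v in T) deg_avoiding S v + 2 <= \sum_(v in T) f v + omega ends (S :|: T).
Proof.
move=> ev; have [F oF] := ex_optimal sends scap.
have le_deg z : deg' F z <= scap z by case: oF => /feasibleP.
have [/forallP sat|] := boolP [forall z, deg' F z == scap z].
  by left; apply: (@factor_of_sfactor F) => z; apply/eqP.
rewrite negb_forall => /existsP[z0 nz0]; right.
have lt : 2 * #|F| < \sum_z scap z.
  rewrite -(sum_deg_total sloopless) (bigD1 z0) //= [ltnRHS](bigD1 z0) //= -addSn.
  by rewrite leq_add ?leq_sum // ltn_neqAle nz0 le_deg.
(* The halves have even total capacity, so parity raises the gap between [2 * #|F|] and the total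
   capacity to two. The reduction lowers the number of edges and the total capacity by equal
   amounts. *)
have evs : ~~ odd (\sum_z scap z).
  rewrite big_sumType /= sum1_card card_prod card_bool oddD oddM andbF addbF.
  exact: ev.
have [g [F' [le_g oF' cF cr]]] := critical_reduction oF.
apply: (barrier_exists le_g oF' cr).
have : (\sum_z scap z)./2.*2 = \sum_z scap z by rewrite -[RHS]odd_double_half (negPf evs).
move: lt cF; clear; rewrite -mul2n; move: (\sum_z scap z) (\sum_z g z) _./2 #|F| #|F'|.
by move=> a b c d e; lia.
Qed.

End Subdivision.

(** * Near-regular factors of tough graphs *)

(** A vertex [v] with least [d v] is chosen and removed with its neighbours; at most [(d v).+1]
    vertices go, each with [phi (d w) <= phi (d v)]. One set [I] serves all antitone [phi]: it is
    used both for [r - d] and for the constant [1]. *)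
Lemma greedy_independent (V : finType) (adj : rel V) (d : V -> nat) (T : {set V}) :
  symmetric adj -> (forall v, v \in T -> #|[set w in T | adj v w]| <= d v) ->
  exists I : {set V}, [/\ I \subset T,
    forall u v, u \in I -> v \in I -> u != v -> ~~ adj u v
  & forall phi : nat -> nat, (forall a b, a <= b -> phi b <= phi a) ->
    \sum_(w in T) phi (d w) <= \sum_(v in I) (d v).+1 * phi (d v)].
Proof.
move=> adj_sym; have [n] := ubnP #|T|; elim: n T => // n IHn T ltn leT.
have [->|[v0 v0T]] := set_0Vmem T.
  by exists set0; split=> [|u v|phi _]; rewrite ?inE // !big_set0.
case: (arg_minnP (P := fun x => x \in T) d v0T) => v /= vT minv.
pose N := [set w in T | (w == v) || adj v w]; pose T' := T :\: N.
have vN : v \in N by rewrite inE vT eqxx.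
have T'T : T' \subset T by apply: subsetDl.
have [||I [IT' indI sumI]] := IHn T'.
- rewrite -ltnS; apply: leq_trans ltn; rewrite ltnS; apply: proper_card; apply/properP; split=> //.
  by exists v; rewrite // inE vN.
- move=> w wT'; apply: leq_trans (leT w (subsetP T'T w wT')).
  by apply/subset_leq_card/subsetP=> x; rewrite !inE => /andP[/andP[_ ->] ->].
have nadj w : w \in I -> ~~ adj v w.
  by move/(subsetP IT'); rewrite !inE => /andP[h wT]; move: h; rewrite wT negb_or => /andP[].
have vI : v \notin I by apply/negP=> /(subsetP IT'); rewrite inE vN.
exists (v |: I); split.
- by rewrite subUset sub1set vT (subset_trans IT').
- move=> x y /setU1P[->|xI] /setU1P[->|yI]; rewrite ?eqxx // => xy; last exact: indI.
    exact: nadj.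
  by rewrite adj_sym nadj.
- move=> phi anti; rewrite big_setU1 //= (big_setID N) /= leq_add //; last exact: sumI.
  rewrite (setIidPr _); last by apply/subsetP=> x; rewrite inE => /andP[].
  apply: (@leq_trans (\sum_(w in N) phi (d v))).
    by apply: leq_sum => w; rewrite inE => /andP[wT _]; apply/anti/minv.
  rewrite sum_nat_const leq_mul2r; apply/orP; right.
  apply: (@leq_trans #|v |: [set w in T | adj v w]|).
    by apply/subset_leq_card/subsetP=> x; rewrite !inE => /andP[-> /orP[->|->]]; rewrite ?orbT.
  rewrite cardsU1 -add1n; apply: leq_add (leq_b1 _) (leT v vT).
Qed.

Lemma barrier_contradiction r s q n A t1 t2 om d1 d2 : 2 <= r ->
  r.+1 * n <= s + q -> q <= r * n -> A + r * n <= r * (r.+1 * n - q) ->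
  t1 <= q + n -> A + d1 = r * t1 -> r.+1 * t2 <= d2 ->
  r * s + (d1 + d2) + 2 <= r * (t1 + t2) + 1 + om -> 2 * om <= s + t1 + t2 + 1 -> False.
Proof.
move=> r2 h1 h2 h3 h4 h5 h6 h7 h8.
have [X eX] : exists X, X + q = r.+1 * n by exists (r.+1 * n - q); lia.
have [y ey] : exists y, s = X + y by exists (s - X); lia.
have eX' : r.+1 * n - q = X by lia.
rewrite eX' in h3; rewrite ey in h7 h8.
(* With [s = X + y], the bounds [h3], [h5], [h6], [h7] give [r * y + r * n + t2 + 1 <= om], whereas
   [h4] and [h8] give [2 * om <= (r + 2) * n + y + t2 + 1]. *)
have rn : 2 * n <= r * n by rewrite leq_mul2r r2 orbT.
have ry : 2 * y <= r * y by rewrite leq_mul2r r2 orbT.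
move: eX rn ry h3 h4 h5 h6 h7 h8; clear; lia.
Qed.

Section NearRegular.
Variables (V E : finType) (ends : E -> V * V) (m r : nat).
Hypotheses (ll : loopless ends) (m0 : 0 < m) (mr : 2 * m <= r).
Hypothesis tough : forall S : {set V},
  2 * m * r * omega ends S <= (r.+1 - 2 * m) * #|S| + 2 * m * r.
Hypothesis iso_tough : forall S : {set V}, r.+1 * iso ends S <= #|S|.

Let adj : rel V := adjD ends setT set0.

Let adjP u v : reflect (exists e, joins ends e u v) (adj u v).
Proof.
rewrite /adj /adjD !in_set0 /=; apply: (iffP exists_inP) => [[e _ h]|[e h]]; by exists e.
Qed.

Let opp_joins p : joins ends p.1 (endpoint ends p) (endpoint ends (opposite p)).
Proof. by case: p => e []; rewrite /endpoint /=; [rewrite joins_sym|]; apply: joins_ends. Qed.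

Let joins_half e u v : joins ends e u v -> exists p, endpoint ends p = u /\ endpoint ends (opposite p) = v.
Proof. by case/joinsP=> -[-> ->]; [exists (e, false)|exists (e, true)]. Qed.

(** Deleting [S] and all the neighbours of [I] isolates every vertex of [I]. *)
Lemma independent_bound (S I : {set V}) : [disjoint S & I] ->
  (forall u v, u \in I -> v \in I -> u != v -> ~~ adj u v) ->
  r.+1 * #|I| <= #|S| + \sum_(v in I) deg_avoiding ends S v.
Proof.
move=> dSI indI; rewrite sum_fiber.
set A := [set p | _ & _]; pose N := [set endpoint ends (opposite p) | p in A].
have NA : #|N| <= #|A| := leq_imset_card _ _.
apply: (@leq_trans #|S :|: N|); last first.
  by apply: leq_trans (leq_card_setU _ _) _; rewrite leq_add2l.
apply: leq_trans (iso_tough (S :|: N)); rewrite leq_mul2l; apply/orP; right.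
apply/subset_leq_card/subsetP=> v vI; rewrite !inE.
have vS : v \notin S by apply/negP=> vS; have /pred0P/(_ v) := dSI; rewrite /= vS vI.
rewrite (negPf vS) /=; apply/andP; split.
  apply/imsetP=> -[p pA ev]; move: pA; rewrite inE => /andP[_ hI].
  have := indI _ _ hI vI; rewrite ev => /(_ _)/negP; apply.
    by case/joinsP: (opp_joins p) (ll p.1) => -[<- <-] //; rewrite eq_sym.
  by apply/adjP; exists p.1; apply: opp_joins.
apply/forallP=> y; apply/negP=> /and3P[_ yS /exists_inP[e _ /joins_half[p [hv hy]]]].
case/negP: yS; rewrite inE -hy; case: (boolP (_ \in S)) => //= yS.
by apply/imsetP; exists p; rewrite // inE yS hv vI.
Qed.

Lemma no_barrier (f : V -> nat) (S T : {set V}) : (forall v, r <= f v) ->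
  \sum_(v in T) f v <= r * #|T| + (0 < #|T|) -> [disjoint S & T] ->
  \sum_(v in S) f v + \sum_(v in T) deg_avoiding ends S v + 2 <=
    \sum_(v in T) f v + omega ends (S :|: T) -> False.
Proof.
move=> f_ge fT dST bar; pose d := deg_avoiding ends S.
have fS : r * #|S| <= \sum_(v in S) f v by rewrite mulnC -sum_nat_const; apply: leq_sum.
have cST : #|S :|: T| = #|S| + #|T|.
  by rewrite cardsU; move: dST; rewrite -setI_eq0 => /eqP->; rewrite cards0 subn0.
(* The slope in [tough] is below one half, so [omega - 1] is strictly less than half of
   [#|S| + #|T|] if [T] is nonempty; integrality then saves one unit. *)
have tST : 2 * omega ends (S :|: T) <= #|S| + #|T| + 2 - (0 < #|T|).
  have := tough (S :|: T); rewrite cST; move: #|S| #|T| (omega _ _) m0 mr => s t om.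
  clear; move=> m0 mr h.
  have km : 2 * (r.+1 - 2 * m) < 2 * m * r by nia.
  have km2 : (2 * m * r) * (2 * om) <= (2 * (r.+1 - 2 * m)) * (s + t) + (2 * m * r) * 2 by nia.
  move: km km2; move: (2 * m * r) (2 * (r.+1 - 2 * m)) => a b ab h2.
  case: t h2 {h} => [|t] h2 /=; rewrite ?subn0 leqNgt; apply/negP=> lt.
    have : a * (s + 0 + 3) <= a * (2 * om) by rewrite leq_mul2l; apply/orP; right; lia.
    have : b * (s + 0) <= a * (s + 0) by rewrite leq_mul2r (ltnW ab) orbT.
    by lia.
  have : a * (s + t.+1 + 2) <= a * (2 * om) by rewrite leq_mul2l; apply/orP; right; lia.
  have : b * (s + t.+1) < a * (s + t.+1) by rewrite ltn_mul2r ab andbT addnS.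
  by lia.
have [T0|T0] := posnP #|T|.
  have rs : 2 * #|S| <= r * #|S| by rewrite leq_mul2r; apply/orP; right; move: m0 mr; clear; lia.
  move: bar fS fT tST rs; rewrite T0 muln0; clear.
  move: (\sum_(v in S) f v) (\sum_(v in T) f v) (\sum_(v in T) _) (omega _ _) => *.
  by lia.
pose T1 := [set v in T | d v <= r].
have T1T : T1 \subset T by apply/subsetP=> v; rewrite inE => /andP[].
have adj_sym : symmetric adj := adjD_sym ends _ _.
have d_ge v : v \in T1 -> #|[set w in T1 | adj v w]| <= d v.
  move=> vT1; apply: leq_trans (leq_imset_card (fun p => endpoint ends (opposite p)) _).
  apply/subset_leq_card/subsetP=> w; rewrite inE => /andP[/(subsetP T1T) wT /adjP[e /joins_half[p [hv hw]]]].
  apply/imsetP; exists p; rewrite // inE hv hw eqxx andbT.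
  by apply/negP=> wS; have /pred0P/(_ w) := dST; rewrite /= wS wT.
have [I [IT indI sumI]] := greedy_independent adj_sym d_ge.
have Ir v : v \in I -> d v <= r by move/(subsetP IT); rewrite inE => /andP[].
pose t2 := #|T :\: T1|.
apply: (@barrier_contradiction r #|S| (\sum_(v in I) d v) #|I| (\sum_(v in T1) (r - d v))
  #|T1| t2 (omega ends (S :|: T)) (\sum_(v in T1) d v) (\sum_(v in T :\: T1) d v)).
- by move: m0 mr; clear; lia.
- apply: independent_bound indI; rewrite disjoint_sym.
  apply: disjointWl (subset_trans IT T1T) _.
  by rewrite disjoint_sym.
- by rewrite mulnC -sum_nat_const; apply: leq_sum.
- have -> : r.+1 * #|I| - \sum_(v in I) d v = \sum_(v in I) (r.+1 - d v).
    have -> : r.+1 * #|I| = \sum_(v in I) ((r.+1 - d v) + d v).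
      rewrite mulnC -sum_nat_const; apply: eq_bigr => v vI; rewrite subnK //.
      exact: leqW (Ir v vI).
    by rewrite big_split /= addnK.
  apply: (@leq_trans (\sum_(v in I) ((d v).+1 * (r - d v) + r))).
    rewrite big_split /= sum_nat_const [#|I| * r]mulnC leq_add2r.
    by apply: sumI => a b ab; apply: leq_sub2l.
  rewrite big_distrr /=; apply: leq_sum => v /Ir; move: (d v) m0 mr; clear.
  move=> a m0 mr ar; have [D ->] : exists D, r = a + D by exists (r - a); lia.
  have -> : a + D - a = D by lia.
  have -> : (a + D).+1 - a = D.+1 by lia.
  (* With [D = r - d v] this is [D <= D * D]. *)
  by case: D => [|D]; nia.
- have := sumI (fun=> 1) (fun _ _ _ => leqnn 1); rewrite sum1_card => /leq_trans-> //.
  rewrite -[#|I|]sum1_card -big_split /=; apply: leq_sum => v _.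
  by rewrite muln1 addn1.
- rewrite -big_split /= mulnC -sum_nat_const; apply: eq_bigr => v.
  by rewrite inE => /andP[_ h]; rewrite subnK.
- rewrite mulnC -sum_nat_const; apply: leq_sum => v; rewrite !inE => /andP[h vT].
  by move: h; rewrite vT /= -ltnNge.
- have -> : \sum_(v in T1) d v + \sum_(v in T :\: T1) d v = \sum_(v in T) d v.
    by rewrite [RHS](big_setID T1) (setIidPr T1T).
  have <- : #|T| = #|T1| + t2 by rewrite -(cardsID T1 T) (setIidPr T1T).
  move: bar fS fT; rewrite T0 -/d; clear.
  move: (\sum_(v in S) f v) (\sum_(v in T) f v) (\sum_(v in T) d v) (omega _ _) (r * _) (r * _) => *.
  by lia.
- move: tST; rewrite T0 -(cardsID T1 T) (setIidPr T1T) -/t2; clear.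
  by move: (omega _ _) #|S| #|T1| => *; lia.
Qed.

Theorem near_regular_factor : exists (F : {set E}) (U : {set V}),
  #|U| <= 1 /\ forall v, deg ends F v = r + (v \in U).
Proof.
have near (U : {set V}) : #|U| <= 1 -> ~~ odd (\sum_v (r + (v \in U))) ->
    exists (F : {set E}) (U : {set V}), #|U| <= 1 /\ forall v, deg ends F v = r + (v \in U).
  move=> U1 ev; have [[F dF]|[S [T [dST bar]]]] := factor_or_barrier ll ev.
    by exists F, U.
  exfalso; apply: no_barrier dST bar => [v|]; first exact: leq_addr.
  rewrite big_split /= sum_nat_const mulnC leq_add2l.
  rewrite -big_mkcondr /= sum1_card.
  have [T0|T0] := posnP #|T|.
    rewrite leqn0; apply/eqP/eq_card0 => v; rewrite unfold_in.
    by have := card0_eq T0 v; rewrite inE => ->.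
  apply: leq_trans U1; apply/subset_leq_card/subsetP=> v.
  by rewrite unfold_in => /andP[].
have [od|ev] := boolP (odd (r * #|V|)); last first.
  apply: (near set0); rewrite ?cards0 //.
  by under eq_bigr => v _ do rewrite inE addn0; rewrite sum_nat_const mulnC.
have /card_gt0P[v0 _] : 0 < #|V| by case: #|V| od => //; rewrite muln0.
apply: (near [set v0]); rewrite ?cards1 //.
rewrite big_split /= sum_nat_const mulnC oddD od.
rewrite (eq_bigr (fun v => (v == v0) : nat)) => [|v _]; last by rewrite inE.
by rewrite (bigD1 v0) //= eqxx big1 // => v /negPf->.
Qed.

End NearRegular.

(** * The factor *)

Lemma simple_tree_connected_factor (V E : finType) (ends : E -> V * V) (m r : nat) :
  loopless ends -> simple ends -> 0 < m -> 2 * m <= r ->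
  (forall S : {set V}, r.+1 * iso ends S <= #|S|) ->
  (forall S : {set V}, 2 * m * r * omega ends S <= (r.+1 - 2 * m) * #|S| + 2 * m * r) ->
  exists F : {set E},
    is_factor ends (fun d => (d == r) || (d == r + 1)) F /\ tree_connected ends m F.
Proof.
move=> ll simp m0 mr isoT tough.
have [F [U [U1 dF]]] := near_regular_factor ll m0 mr tough isoT.
have dF' v : r <= deg ends F v by rewrite dF leq_addr.
have [M [mM dFM MU tc]] := connecting_matching ll simp m0 mr U1 dF' tough.
exists (F :|: M); split=> // v.
have -> : deg ends (F :|: M) v = deg ends F v + deg ends M v.
  rewrite /deg -[RHS]cardsUI (_ : _ :&: _ = set0) ?cards0 ?addn0.
    by apply: eq_card => e; rewrite !inE andb_orl.
  apply/setP=> e; rewrite !inE; apply/negP=> /andP[/andP[eF _] /andP[eM _]].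
  by have /pred0P/(_ e) := dFM; rewrite /= eF eM.
have dM : deg ends M v <= 1.
  rewrite leqNgt; apply/negP=> /card_gt1P[e [f [eM fM ef]]]; move: eM fM.
  rewrite !inE => /andP[eM ev] /andP[fM fv].
  by rewrite (mM e f v eM fM ev fv) eqxx in ef.
have dMU : v \in U -> deg ends M v = 0.
  move=> vU; apply/eqP; rewrite cards_eq0; apply/eqP/setP=> e; rewrite !inE.
  by apply/negP=> /andP[/MU/insideP h /h]; rewrite inE vU.
rewrite dF; case: (boolP (v \in U)) => [/dMU->|_]; first by rewrite addn0 eqxx orbT.
by case: (deg ends M v) dM => [|[]] //= _; rewrite !addn0 eqxx ?orbT.
Qed.

(** * Reduction to simple graphs *)

Section Simplification.
Variables (V E : finType) (ends : E -> V * V).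
Hypothesis ll : loopless ends.

(** [pick] depends only on the values of its predicate, so parallel edges get the same
    representative; the fixed points of [rep] are the edges of the simple graph. *)
Let rep (e : E) : E := odflt e [pick e' | joins ends e' (ends e).1 (ends e).2].

Let rep_joins e : joins ends (rep e) (ends e).1 (ends e).2.
Proof. by rewrite /rep; case: pickP => //= /(_ e); rewrite joins_ends. Qed.

Let joins_eq e f x y : joins ends e x y -> joins ends f x y -> rep e = rep f.
Proof.
move=> je jf; rewrite /rep (eq_pick (Q := fun e' => joins ends e' x y)) => [|e'].
  rewrite [in RHS](eq_pick (Q := fun e' => joins ends e' x y)) => [|e'].
    by case: pickP => // /(_ e); rewrite je.
  by case: (joinsP jf) => -[-> ->] //; rewrite joins_sym.
by case: (joinsP je) => -[-> ->] //; rewrite joins_sym.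
Qed.

Let rep_rep e : rep (rep e) = rep e.
Proof. exact: joins_eq (rep_joins e) (joins_ends ends e). Qed.

Local Notation E1 := {e : E | rep e == e}.

Definition simplified (e : E1) : V * V := ends (val e).

Lemma simplified_loopless : loopless simplified.
Proof. by move=> e; apply: ll. Qed.

Lemma simplified_simple : simple simplified.
Proof.
move=> e f x y je jf; apply: val_inj.
by rewrite -(eqP (valP e)) -(eqP (valP f)); apply: joins_eq je jf.
Qed.

Lemma adjD_simplified S : adjD simplified setT S =2 adjD ends setT S.
Proof.
move=> x y; rewrite /adjD; congr [&& _, _ & _].
apply/exists_inP/exists_inP=> [[e _ j]|[e _ j]]; first by exists (val e).
have re : rep (rep e) == rep e by rewrite rep_rep.
exists (exist _ (rep e) re) => //; rewrite /joins /simplified /= -/(joins ends (rep e) x y).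
by case: (joinsP j) => -[-> ->]; rewrite ?rep_joins // joins_sym rep_joins.
Qed.

Lemma omega_simplified S : omega simplified S = omega ends S.
Proof.
rewrite /omega; congr #|pred_of_set _|; apply: eq_imset => x.
by apply/setP=> y; rewrite !inE; apply: eq_connect; apply: adjD_simplified.
Qed.

Lemma iso_simplified S : iso simplified S = iso ends S.
Proof.
apply: eq_card => x; rewrite !inE; congr (_ && _).
by apply: eq_forallb => y; rewrite adjD_simplified.
Qed.

Lemma deg_simplified (F : {set E1}) v : deg ends (val @: F) v = deg simplified F v.
Proof.
rewrite /deg -[RHS](card_imset _ val_inj); apply: eq_card => e; rewrite inE.
apply/andP/imsetP=> [[/imsetP[f fF ->] ev]|[f + ->]]; first by exists f; rewrite // inE fF.
by rewrite inE => /andP[fF fv]; rewrite imset_f.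
Qed.

Lemma adjD_image (F : {set E1}) S : adjD ends (val @: F) S =2 adjD simplified F S.
Proof.
move=> x y; rewrite /adjD; congr [&& _, _ & _].
apply/exists_inP/exists_inP=> [[_ /imsetP[e eF ->] j]|[e eF j]]; first by exists e.
by exists (val e) => //; apply: imset_f.
Qed.

Lemma spanning_tree_image (F : {set E1}) :
  spanning_tree simplified F -> spanning_tree ends (val @: F).
Proof.
move=> [co ac]; split=> [x y|_ /imsetP[e eF ->]].
  by rewrite (eq_connect (adjD_image F set0)).
have -> : (val @: F) :\ val e = val @: (F :\ e).
  apply/setP=> f; rewrite in_setD1; apply/andP/imsetP=> [[fe /imsetP[g gF eg]]|[g + ->]].
    by exists g; rewrite // in_setD1 gF andbT; apply: contraNneq fe => <-; rewrite eg.
  by rewrite in_setD1 => /andP[ge gF]; rewrite (inj_eq val_inj) ge imset_f.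
by rewrite (eq_connect (adjD_image _ set0)); apply: ac.
Qed.

Lemma tree_connected_image m (F : {set E1}) :
  tree_connected simplified m F -> tree_connected ends m (val @: F).
Proof.
move=> [T [sT [tT dT]]]; exists (fun i => val @: T i); split=> [i|]; first exact: imsetS.
split=> [i|i j ij]; first exact: spanning_tree_image.
rewrite -setI_eq0; apply/eqP/setP=> e; rewrite !inE; apply/negP.
case/andP=> /imsetP[f fi ->] /imsetP[g gj /val_inj efg].
by have /pred0P/(_ f) := dT i j ij; rewrite /= fi efg gj.
Qed.

End Simplification.

(** * From the real hypotheses to inequalities between natural numbers *)

Section Numbers.
Variables (m r : nat) (eps : R).
Hypotheses (m0 : 0 < m) (eps0 : (0 < eps)%R).
Hypothesis large : (INR (2 * m - 1) * (2 * INR m / eps + 1) <= INR r)%R.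

Let m1 : (1 <= INR m)%R.
Proof. by rewrite -[1%R]/(INR 1); apply: le_INR; apply/leP. Qed.

Let mE : INR (2 * m - 1) = (2 * INR m - 1)%R.
Proof.
rewrite minus_INR; last by apply/leP; rewrite muln_gt0.
by rewrite mult_INR.
Qed.

Let quot_pos : (0 < 2 * INR m / eps)%R.
Proof. by apply: Rdiv_lt_0_compat => //; lra. Qed.

Lemma degree_large : 2 * m <= r.
Proof.
have : (INR (2 * m - 1) < INR r)%R by have := large; rewrite mE; nra.
by move/INR_lt/ltP; move: m0; clear; lia.
Qed.

Lemma isolated_nat a s : (INR a <= INR s / INR (r + 1))%R -> r.+1 * a <= s.
Proof.
move=> h; apply/leP/INR_le; rewrite mult_INR -addn1.
have r0 : (0 < INR (r + 1))%R by apply: lt_0_INR; apply/ltP; rewrite addn1.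
apply: (Rmult_le_reg_r (/ INR (r + 1))); first exact: Rinv_0_lt_compat.
by rewrite Rmult_comm -Rmult_assoc Rinv_l; lra.
Qed.

Lemma tough_nat w s : (INR w <= / (2 * INR m + eps) * INR s + 1)%R ->
  2 * m * r * w <= (r.+1 - 2 * m) * s + 2 * m * r.
Proof.
move=> h; have mr := degree_large.
set k := r.+1 - 2 * m; have kE : INR k = (INR r - (2 * INR m - 1))%R.
  rewrite /k minus_INR ?S_INR ?mult_INR /=; last by apply/leP; apply: leqW.
  by lra.
have k0 : (0 <= INR k)%R by apply: pos_INR.
have s0 : (0 <= INR s)%R by apply: pos_INR.
(* The bound on [r] multiplied by [eps] and rewritten in terms of [k]. *)
have key : (2 * INR m * (2 * INR m - 1) <= eps * INR k)%R.
  have : ((2 * INR m - 1) * (2 * INR m / eps + 1) * eps <= INR r * eps)%R.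
    by apply: Rmult_le_compat_r; [lra | rewrite -mE].
  have -> : ((2 * INR m - 1) * (2 * INR m / eps + 1) * eps = (2 * INR m - 1) * (2 * INR m + eps))%R.
    by field; lra.
  by rewrite kE; lra.
have [w1|w1] := leqP w 1.
  by apply: leq_trans (leq_addl _ _); rewrite -[leqRHS]muln1 leq_mul2l w1 orbT.
apply/leP/INR_le; rewrite plus_INR !mult_INR -[INR 2]/(2%R).
have w1' : (0 <= INR w - 1)%R.
  have : (INR 1 <= INR w)%R by apply: le_INR; apply/leP; apply: ltnW.
  by rewrite -[INR 1]/1%R; lra.
have hs : ((INR w - 1) * (2 * INR m + eps) <= INR s)%R.
  have p : (0 < 2 * INR m + eps)%R by lra.
  have : ((INR w - 1) * (2 * INR m + eps) <= (/ (2 * INR m + eps) * INR s) * (2 * INR m + eps))%R.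
    by apply: Rmult_le_compat_r; lra.
  have -> : (/ (2 * INR m + eps) * INR s * (2 * INR m + eps) = INR s)%R by field; lra.
  by [].
(* [h1] and [h2] add up to [2 * m * (w - 1) * (k + 2 * m - 1) <= k * s], and [k + 2 * m - 1 = r]. *)
have h1 := Rmult_le_compat_l _ _ _ k0 hs.
have h2 := Rmult_le_compat_l _ _ _ w1' key.
rewrite kE in h1 h2 *; lra.
Qed.

End Numbers.

Theorem mainTheorem13 (m r : nat) (eps : R)
  (V E : finType) (ends : E -> V * V) :
  (0 < m)%N -> (0 < r)%N -> (0 < eps)%R ->
  (INR (2 * m - 1) * (2 * INR m / eps + 1) <= INR r)%R ->
  loopless ends ->
  (forall S : {set V}, (INR (iso ends S) <= INR #|S| / INR (r + 1))%R) ->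
  (forall S : {set V},
      (INR (omega ends S) <= / (2 * INR m + eps) * INR #|S| + 1)%R) ->
  exists F : {set E},
    is_factor ends (fun d => (d == r) || (d == r + 1)) F /\
    tree_connected ends m F.
Proof.
move=> m0 _ eps0 large ll isoT tough.
have [S|S|F [degF tcF]] := simple_tree_connected_factor (simplified_loopless ll)
  (@simplified_simple _ _ ends) m0 (degree_large m0 eps0 large).
- by rewrite iso_simplified; apply: isolated_nat.
- by rewrite omega_simplified; apply: (tough_nat m0 eps0 large).
exists (val @: F); split; last exact: tree_connected_image.
by move=> v; rewrite deg_simplified.
Qed.
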